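(* The following are equivalent over GBC: (i) the principle $\mathrm{ETR}_{\mathrm{Ord}}$; (ii) for every class $A$ there is a truth predicate for $\mathcal L_{\mathrm{Ord},\omega}(\in,A)$; (iii) the class-join separation principle plus $\mathrm{ETR}_{\mathrm{Ord}}$-foundation; (iv) the class-meet separation principle plus $\mathrm{ETR}_{\mathrm{Ord}}$-foundation.
   Context: $\mathrm{ETR}_{\mathrm{Ord}}$: for every first-order formula $\varphi(x,X,A)$ and class $A$ there is a class $S\subseteq\mathrm{Ord}\times V$ (a solution) with $S_\alpha=\{x:\varphi(x,S\restriction\alpha,A)\}$ for all $\alpha$, where $S_\alpha=\{x:\langle\alpha,x\rangle\in S\}$, $S\restriction\alpha=S\cap(\alpha\times V)$. $\mathrm{ETR}_{\mathrm{Ord}}$-foundation: every such recursion either has a solution, or there is $\alpha\le\mathrm{Ord}$ such that for every $\beta<\alpha$ there is a solution of the recursion of length $\beta$ but there is none of length $\alpha$. $\mathcal L_{\mathrm{Ord},\omega}(\in,\hat A)$: formulas built from $x=y$, $x\in y$, $x\in\hat A$ by negation, set-sized conjunctions with finitely many free variables in total, and universal quantifiers. A truth predicate for a collection of such formulas (closed under subformulas) is a class $\mathbb T$ of pairs $\langle\varphi,\vec a\rangle$ ($\vec a$ a valuation) with atomic formulas judged correctly ($a=b$, $a\in b$, $a\in A$), $\mathbb T(\bigwedge_i\varphi_i,\vec a)$ iff all $\mathbb T(\varphi_i,\vec a)$, $\mathbb T(\neg\varphi,\vec a)$ iff not $\mathbb T(\varphi,\vec a)$, $\mathbb T(\forall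 x\varphi,\vec a)$ iff $\mathbb T(\varphi,b^\frown\vec a)$ for all $b$. Class-join separation: for any class $A$ and any class $\Phi$ of $\mathcal L_{\mathrm{Ord},\omega}(\in,A)$-formulas in finitely many free variables, if every $\varphi\in\Phi$ admits a truth predicate $T_\varphi$ (for $\varphi$ and its subformulas), then $\{\vec a:\exists\varphi\in\Phi\ T_\varphi(\varphi,\vec a)\}$ exists as a class. Class-meet separation: under the same hypothesis, $\{\vec a:\forall\varphi\in\Phi\ T_\varphi(\varphi,\vec a)\}$ exists as a class. *)

(* Defs.v *)
From Stdlib Require Import Vector.
Import VectorNotations.

Set Implicit Arguments.
Unset Strict Implicit.

(* A structure for second-order set theory: a domain of sets with a membership
   relation, and a collection of subsets of the domain, the classes.  Classes
   being subsets, extensionality of classes is built in.  Nothing is assumed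
   to be well founded or standard from the outside, so every set-theoretic
   notion below is defined inside the structure. *)
Record gb_structure : Type := GBStructure {
  carrier :> Type;
  mem : carrier -> carrier -> Prop;
  is_class : (carrier -> Prop) -> Prop
}.

Notation "x ∈ y" := (mem x y) (at level 70, no associativity).

(* First-order formulas: quantifiers range over sets only.  There are [c] class
   variables and [n] set variables; [f_all] binds the set variable of index 0
   and shifts the others (de Bruijn indices). *)
Inductive formula (c n : nat) : Type :=
| f_eq (i j : Fin.t n)
| f_mem (i j : Fin.t n)
| f_in (i : Fin.t n) (k : Fin.t c)
| f_neg (p : formula c n)
| f_and (p q : formula c n)
| f_all (p : formula c (S n)).
Arguments f_eq {c n} i j.
Arguments f_mem {c n} i j.

Fixpoint sat {M : gb_structure} {c n : nat} (C : Vector.t (M -> Prop) c)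
    (p : formula c n) (v : Vector.t M n) {struct p} : Prop :=
  match p with
  | f_eq i j => nth v i = nth v j
  | f_mem i j => nth v i ∈ nth v j
  | f_in i k => nth C k (nth v i)
  | f_neg p => ~ sat C p v
  | f_and p q => sat C p v /\ sat C q v
  | f_all p => forall x : M, sat C p (x :: v)
  end.

Definition elems {M : gb_structure} (a : M) : M -> Prop := fun x => x ∈ a.

Definition is_empty {M : gb_structure} (z : M) : Prop := forall w, ~ w ∈ z.

Definition is_upair {M : gb_structure} (z x y : M) : Prop :=
  forall w, w ∈ z <-> w = x \/ w = y.

(* [z] is the Kuratowski pair <x,y> = {{x},{x,y}} *)
Definition is_opair {M : gb_structure} (z x y : M) : Prop :=
  exists a b, is_upair a x x /\ is_upair b x y /\ is_upair z a b.

(* [z] is y ∪ {x} *)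
Definition is_adjoin {M : gb_structure} (z y x : M) : Prop :=
  forall w, w ∈ z <-> w ∈ y \/ w = x.

Definition is_succ {M : gb_structure} (z y : M) : Prop := is_adjoin z y y.

(* <x,y> belongs to the class [R] *)
Definition related {M : gb_structure} (R : M -> Prop) (x y : M) : Prop :=
  exists p, is_opair p x y /\ R p.

Definition functional {M : gb_structure} (F : M -> Prop) : Prop :=
  forall x y z, related F x y -> related F x z -> y = z.

Record GBC (M : gb_structure) : Prop := {
  gbc_extensionality : forall x y : M, (forall z, z ∈ x <-> z ∈ y) -> x = y;
  gbc_pairing : forall x y : M, exists z, is_upair z x y;
  gbc_union : forall x : M, exists u, forall z, z ∈ u <-> exists y, y ∈ x /\ z ∈ y;
  gbc_power : forall x : M, exists u, forall z, z ∈ u <-> (forall w, w ∈ z -> w ∈ x);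
  gbc_infinity : exists u : M,
    (exists e, is_empty e /\ e ∈ u) /\
    (forall x, x ∈ u -> exists y, is_succ y x /\ y ∈ u);
  gbc_foundation : forall X : M -> Prop, is_class X -> (exists x, X x) ->
    exists x, X x /\ forall y, y ∈ x -> ~ X y;
  (* the class function [F] may be partial, so this yields separation as well *)
  gbc_replacement : forall F : M -> Prop, is_class F -> functional F ->
    forall a : M, exists b, forall y, y ∈ b <-> exists x, x ∈ a /\ related F x y;
  gbc_comprehension : forall (c n : nat) (p : formula c (S n))
      (C : Vector.t (M -> Prop) c) (v : Vector.t M n),
    Forall (@is_class M) C -> is_class (fun x => sat C p (x :: v));
  gbc_global_choice : exists F : M -> Prop, is_class F /\ functional F /\
    forall x : M, (exists y, y ∈ x) -> exists y, y ∈ x /\ related F x y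
}.

(* A transitive set well-ordered by membership; irreflexivity and transitivity
   of the order follow from the existence of minimal elements of subsets. *)
Definition Ord {M : gb_structure} (a : M) : Prop :=
  (forall x y, x ∈ a -> y ∈ x -> y ∈ a) /\
  (forall x y, x ∈ a -> y ∈ a -> x ∈ y \/ x = y \/ y ∈ x) /\
  (forall s : M, (forall x, x ∈ s -> x ∈ a) -> (exists x, x ∈ s) ->
     exists x, x ∈ s /\ forall y, y ∈ s -> ~ y ∈ x).

(* The restriction of [S] to [a], that is S ∩ (a × V). *)
Definition restr {M : gb_structure} (S : M -> Prop) (a : M) : M -> Prop :=
  fun p => S p /\ exists b x, b ∈ a /\ is_opair p b x.

(* [S] solves the recursion given by [phi] and [A] along [L], which is either
   the class of all ordinals or the class of elements of an ordinal.  In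
   [phi], the class variables 0 and 1 stand for X and A. *)
Definition solution {M : gb_structure} (phi : formula 2 1) (A L S : M -> Prop)
    : Prop :=
  is_class S /\
  (forall p, S p -> exists a x, L a /\ is_opair p a x) /\
  (forall a x, L a -> (related S a x <-> sat [restr S a; A] phi [x])).

Definition ETR_Ord (M : gb_structure) : Prop :=
  forall (phi : formula 2 1) (A : M -> Prop), is_class A ->
    exists S, solution phi A Ord S.

(* [L] is a length α ≤ Ord; the lengths β < α are then the elements of [L]. *)
Definition ETR_Ord_foundation (M : gb_structure) : Prop :=
  forall (phi : formula 2 1) (A : M -> Prop), is_class A ->
    (exists S, solution phi A Ord S) \/
    (exists L : M -> Prop,
       (L = Ord \/ exists a, Ord a /\ L = elems a) /\
       (forall b, L b -> exists S, solution phi A (elems b) S) /\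
       ~ (exists S, solution phi A L S)).

Definition is_natural {M : gb_structure} (n : M) : Prop :=
  Ord n /\ forall m, m ∈ n \/ m = n -> is_empty m \/ exists k, is_succ m k.

(* [f] is a function with domain [d] *)
Definition is_fun {M : gb_structure} (f d : M) : Prop :=
  (forall p, p ∈ f -> exists x y, x ∈ d /\ is_opair p x y) /\
  (forall x, x ∈ d -> exists y, related (elems f) x y) /\
  functional (elems f).

Definition is_finite {M : gb_structure} (d : M) : Prop :=
  exists n f, is_natural n /\ is_fun f n /\
    (forall x x' y, related (elems f) x y -> related (elems f) x' y -> x = x') /\
    (forall y, y ∈ d <-> exists x, related (elems f) x y).

(* The infinitary formulas are sets of the structure.  The variables are the
   x_i for i a natural number of the structure, and the codes are
     x_i = x_j : <0,<i,j>>      x_i ∈ x_j : <1,<i,j>>     x_i ∈ Â : <2,i>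
     ¬ψ : <3,ψ>      ⋀Ψ : <4,Ψ> for a set Ψ of formulas     ∀x_i ψ : <5,<i,ψ>> *)
Fixpoint is_numeral {M : gb_structure} (k : nat) (z : M) : Prop :=
  match k with
  | 0 => is_empty z
  | S k => exists y, is_numeral k y /\ is_succ z y
  end.

Definition is_tagged {M : gb_structure} (k : nat) (z x : M) : Prop :=
  exists t, is_numeral k t /\ is_opair z t x.

Definition L_eq {M : gb_structure} (p i j : M) : Prop :=
  exists q, is_opair q i j /\ is_tagged 0 p q.
Definition L_mem {M : gb_structure} (p i j : M) : Prop :=
  exists q, is_opair q i j /\ is_tagged 1 p q.
Definition L_in {M : gb_structure} (p i : M) : Prop := is_tagged 2 p i.
Definition L_neg {M : gb_structure} (p q : M) : Prop := is_tagged 3 p q.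
Definition L_conj {M : gb_structure} (p Q : M) : Prop := is_tagged 4 p Q.
Definition L_all {M : gb_structure} (p i q : M) : Prop :=
  exists r, is_opair r i q /\ is_tagged 5 p r.

Definition is_varset {M : gb_structure} (d : M) : Prop :=
  is_finite d /\ forall i, i ∈ d -> is_natural i.

(* [p] is an infinitary formula whose free variables are among the finitely
   many x_i, i ∈ d: some set [s] of pairs <formula, variable set> contains
   <p,d> and each pair in [s] is obtained by a formation rule from pairs in
   [s].  Subformulas have smaller rank than the formula, so by foundation no
   inductive clause is needed.  The conjunction rule demands one finite set of
   variables for all conjuncts. *)
Definition L_formula_in {M : gb_structure} (p d : M) : Prop :=
  is_varset d /\
  exists s : M, related (elems s) p d /\
    forall q e, related (elems s) q e ->
      (exists i j, i ∈ e /\ j ∈ e /\ (L_eq q i j \/ L_mem q i j)) \/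
      (exists i, i ∈ e /\ L_in q i) \/
      (exists r, L_neg q r /\ related (elems s) r e) \/
      (exists R, L_conj q R /\ forall r, r ∈ R -> related (elems s) r e) \/
      (exists i r e', is_natural i /\ L_all q i r /\
         is_adjoin e' e i /\ related (elems s) r e').

Definition L_formula {M : gb_structure} (p : M) : Prop :=
  exists d, L_formula_in p d.

Definition immediate_subformula {M : gb_structure} (q p : M) : Prop :=
  L_neg p q \/ (exists Q, L_conj p Q /\ q ∈ Q) \/ (exists i, L_all p i q).

(* [q] is [p] itself or a proper subformula of [p] *)
Definition subformula {M : gb_structure} (q p : M) : Prop :=
  forall s : M, p ∈ s ->
    (forall r r', r ∈ s -> immediate_subformula r' r -> r' ∈ s) -> q ∈ s.

(* [a] assigns sets to a finite set of variables including the free ones of [p] *)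
Definition is_valuation {M : gb_structure} (a p : M) : Prop :=
  exists d, is_fun a d /\ L_formula_in p d.

(* [a'] is the valuation [a] with the value of x_i set to [b] *)
Definition is_update {M : gb_structure} (a' a i b : M) : Prop :=
  forall q, q ∈ a' <->
    is_opair q i b \/ (q ∈ a /\ exists j y, j <> i /\ is_opair q j y).

(* [T] is a truth predicate, with Â interpreted as [A], for the collection [D]
   of infinitary formulas, which is meant to be closed under subformulas. *)
Definition truth_predicate {M : gb_structure} (A D T : M -> Prop) : Prop :=
  is_class T /\
  (forall t, T t -> exists p a, D p /\ is_valuation a p /\ is_opair t p a) /\
  (forall p a, D p -> is_valuation a p ->
    (forall i j, L_eq p i j -> (related T p a <->
       exists x y, related (elems a) i x /\ related (elems a) j y /\ x = y)) /\
    (forall i j, L_mem p i j -> (related T p a <->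
       exists x y, related (elems a) i x /\ related (elems a) j y /\ x ∈ y)) /\
    (forall i, L_in p i -> (related T p a <->
       exists x, related (elems a) i x /\ A x)) /\
    (forall q, L_neg p q -> (related T p a <-> ~ related T q a)) /\
    (forall Q, L_conj p Q -> (related T p a <->
       forall q, q ∈ Q -> related T q a)) /\
    (forall i q, L_all p i q -> (related T p a <->
       forall b a', is_update a' a i b -> related T q a'))).

Definition Ord_omega_truth (M : gb_structure) : Prop :=
  forall A : M -> Prop, is_class A -> exists T, truth_predicate A L_formula T.

(* [T] is a truth predicate for [p] and its subformulas *)
Definition truth_predicate_for {M : gb_structure} (A : M -> Prop) (p : M)
    (T : M -> Prop) : Prop :=
  truth_predicate A (fun q => subformula q p) T.

(* T_p(p,a); truth predicates for [p] agree with each other, so it does not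
   matter which one is used. *)
Definition true_at {M : gb_structure} (A : M -> Prop) (p a : M) : Prop :=
  exists T, truth_predicate_for A p T /\ related T p a.

(* In the two separation principles, [d] is the finite set of variables in
   which all formulas of [Phi] are written. *)
Definition class_join_separation (M : gb_structure) : Prop :=
  forall (A Phi : M -> Prop) (d : M), is_class A -> is_class Phi ->
    is_varset d -> (forall p, Phi p -> L_formula_in p d) ->
    (forall p, Phi p -> exists T, truth_predicate_for A p T) ->
    is_class (fun a => is_fun a d /\ exists p, Phi p /\ true_at A p a).

Definition class_meet_separation (M : gb_structure) : Prop :=
  forall (A Phi : M -> Prop) (d : M), is_class A -> is_class Phi ->
    is_varset d -> (forall p, Phi p -> L_formula_in p d) ->
    (forall p, Phi p -> exists T, truth_predicate_for A p T) ->
    is_class (fun a => is_fun a d /\ forall p, Phi p -> true_at A p a).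

(* Main.v *)
(* Truth of infinitary formulas is a recursion of length Ord on their depth, and
   conversely the stages of a recursion are definable by infinitary formulas, one
   for each ordinal, obtained from its first-order definition by replacing the
   solution so far by the disjunction of the formulas for the earlier stages.
   So a full truth predicate is as good as all solutions.  For the separation
   principles, suppose that the recursion for truth itself breaks down at a
   length L, which must then be a limit.  The formula defining its stage b has
   depth less than the next limit after b, so for b < L it has a truth predicate,
   read off a solution of some length below L.  A join (of these formulas) or a
   meet (of their negations) then collects the stages below L into a solution of
   length L, a contradiction. *)
From Stdlib Require Import Vector Classical ClassicalEpsilon PeanoNat.
From Stdlib Require Import FunctionalExtensionality PropExtensionality Lia.
Require Import Defs.
Import VectorNotations.

(** * First-order definability *)

(** The infinitary language has no names for sets, so the formula for stage b cannot mention b. Each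
    stage is therefore defined together with a marker, as the set {b} ∪ {b} × S_b. Ordered pairs are
    never ordinals, so the ordinals in the union of the earlier marked stages are exactly the
    elements of b, and b can be recovered from that union. The language has only conjunctions, so
    the recursion carries the negation of each definition: the conjunction of the earlier ones says
    that no earlier stage contains x_0. The depth bound is a count. Over the earlier definitions,
    each new one adds a fixed standard number k of formula layers, so stage b is decided by about
    step (k+1)·b, and multiplying by a finite number does not lead past a limit ordinal. The
    structure may be ill founded from outside, so every induction is internal and runs over a class.
    Each induction hypothesis must be shown first-order, and this is what [fo] and its tactic are
    for. *)

Section Definability.
Context {M : gb_structure}.
Implicit Types (Good : (M -> Prop) -> Prop) (X : M -> Prop).

Fixpoint rename_classes {c c' n : nat} (f : Fin.t c -> Fin.t c')
    (p : formula c n) : formula c' n :=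
  match p with
  | f_eq i j => f_eq i j
  | f_mem i j => f_mem i j
  | f_in i k => f_in i (f k)
  | f_neg p => f_neg (rename_classes f p)
  | f_and p q => f_and (rename_classes f p) (rename_classes f q)
  | f_all p => f_all (rename_classes f p)
  end.

Lemma sat_rename_classes {c c' n : nat} (f : Fin.t c -> Fin.t c')
    (p : formula c n) (C : Vector.t (M -> Prop) c)
    (C' : Vector.t (M -> Prop) c') (v : Vector.t M n) :
  (forall k, nth C' (f k) = nth C k) ->
  (sat C' (rename_classes f p) v <-> sat C p v).
Proof.
  intros H; induction p; simpl.
  - reflexivity.
  - reflexivity.
  - now rewrite H.
  - now rewrite IHp.
  - now rewrite IHp1, IHp2.
  - split; intros K x; apply IHp, K.
Qed.

Fixpoint rename_vars {c n n' : nat} (is : Vector.t (Fin.t n') n)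
    (p : formula c n) : formula c n' :=
  match p with
  | f_eq i j => f_eq (nth is i) (nth is j)
  | f_mem i j => f_mem (nth is i) (nth is j)
  | f_in i k => f_in (nth is i) k
  | f_neg p => f_neg (rename_vars is p)
  | f_and p q => f_and (rename_vars is p) (rename_vars is q)
  | f_all p => f_all (rename_vars (Fin.F1 :: map Fin.FS is) p)
  end.

Lemma sat_rename_vars {c n : nat} (p : formula c n)
    (C : Vector.t (M -> Prop) c) :
  forall n' (is : Vector.t (Fin.t n') n) (v : Vector.t M n'),
  sat C (rename_vars is p) v <-> sat C p (map (nth v) is).
Proof.
  induction p; intros n' is v; simpl.
  - now rewrite !(nth_map (nth v) is _ _ eq_refl).
  - now rewrite !(nth_map (nth v) is _ _ eq_refl).
  - now rewrite !(nth_map (nth v) is _ _ eq_refl).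
  - now rewrite IHp.
  - now rewrite IHp1, IHp2.
  - split; intros K x; specialize (K x).
    + apply IHp in K; simpl in K; now rewrite map_map in K.
    + apply IHp; simpl; now rewrite map_map.
Qed.

(* [P] is uniformly first-order in the class variable [X], with further class
   parameters allowed only among those satisfying [Good]. *)
Definition fo Good (n : nat) (P : (M -> Prop) -> Vector.t M n -> Prop) : Prop :=
  exists c (K : Vector.t (M -> Prop) c) (p : formula (S c) n),
    Forall Good K /\ forall X v, P X v <-> sat (X :: K) p v.

Definition fo_term Good (n : nat) (t : (M -> Prop) -> Vector.t M n -> M) : Prop :=
  fo Good (S n) (fun X v => hd v = t X (tl v)).

Context {Good : (M -> Prop) -> Prop}.
Arguments fo Good {n} P.
Arguments fo_term Good {n} t.

Lemma fo_iff {n} (P Q : (M -> Prop) -> Vector.t M n -> Prop) :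
  (forall X v, P X v <-> Q X v) -> fo Good P -> fo Good Q.
Proof.
  intros H (c & K & p & HK & Hp); exists c, K, p; split; [easy|].
  intros X v; now rewrite <- H.
Qed.

Lemma fo_and {n} (P Q : (M -> Prop) -> Vector.t M n -> Prop) :
  fo Good P -> fo Good Q -> fo Good (fun X v => P X v /\ Q X v).
Proof.
  intros (c & K & p & HK & Hp) (c' & K' & p' & HK' & Hp').
  (* Both formulas keep [X] as class variable 0; the parameters of the second are placed behind
     those of the first. *)
  set (f := fun k : Fin.t (S c) => Fin.caseS' k (fun _ => Fin.t (S (c + c')))
    Fin.F1 (fun k => Fin.FS (Fin.L c' k))).
  set (f' := fun k : Fin.t (S c') => Fin.caseS' k (fun _ => Fin.t (S (c + c')))
    Fin.F1 (fun k => Fin.FS (Fin.R c k))).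
  exists (c + c'), (append K K'),
    (f_and (rename_classes f p) (rename_classes f' p')); split.
  - now apply Forall_append.
  - intros X v; simpl. rewrite Hp, Hp'.
    rewrite (sat_rename_classes f p (X :: K)), (sat_rename_classes f' p' (X :: K')).
    + reflexivity.
    + intros k; apply (Fin.caseS' k); simpl; [easy|]; intros; apply nth_append_R.
    + intros k; apply (Fin.caseS' k); simpl; [easy|]; intros; apply nth_append_L.
Qed.

Lemma fo_not {n} (P : (M -> Prop) -> Vector.t M n -> Prop) :
  fo Good P -> fo Good (fun X v => ~ P X v).
Proof.
  intros (c & K & p & HK & Hp); exists c, K, (f_neg p); split; [easy|].
  intros X v; simpl; now rewrite Hp.
Qed.

Lemma fo_all {n} (P : (M -> Prop) -> Vector.t M n -> M -> Prop) :
  fo Good (n := S n) (fun X v => P X (tl v) (hd v)) ->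
  fo Good (fun X v => forall x, P X v x).
Proof.
  intros (c & K & p & HK & Hp); exists c, K, (f_all p); split; [easy|].
  intros X v; simpl; split; intros H x; apply (Hp X (x :: v)), H.
Qed.

Lemma fo_or {n} (P Q : (M -> Prop) -> Vector.t M n -> Prop) :
  fo Good P -> fo Good Q -> fo Good (fun X v => P X v \/ Q X v).
Proof.
  intros HP HQ; apply fo_iff with (fun X v => ~ (~ P X v /\ ~ Q X v)).
  - intros; tauto.
  - now apply fo_not, fo_and; apply fo_not.
Qed.

Lemma fo_imp {n} (P Q : (M -> Prop) -> Vector.t M n -> Prop) :
  fo Good P -> fo Good Q -> fo Good (fun X v => P X v -> Q X v).
Proof.
  intros HP HQ; apply fo_iff with (fun X v => ~ (P X v /\ ~ Q X v)).
  - intros; tauto.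
  - now apply fo_not, fo_and; [|apply fo_not].
Qed.

Lemma fo_iff_conn {n} (P Q : (M -> Prop) -> Vector.t M n -> Prop) :
  fo Good P -> fo Good Q -> fo Good (fun X v => P X v <-> Q X v).
Proof. intros HP HQ; now apply fo_and; apply fo_imp. Qed.

Lemma fo_ex {n} (P : (M -> Prop) -> Vector.t M n -> M -> Prop) :
  fo Good (n := S n) (fun X v => P X (tl v) (hd v)) ->
  fo Good (fun X v => exists x, P X v x).
Proof.
  intros H; apply fo_iff with (fun X v => ~ forall x, ~ P X v x).
  - intros X v; split.
    + intros K; apply NNPP; intros N; apply K; intros x Hx; apply N; now exists x.
    + intros (x & Hx) K; exact (K x Hx).
  - apply fo_not, fo_all, fo_not, H.
Qed.

(** [Q] depends neither on [X] nor on the variables, so classically it is settled once and for all,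
    and a trivially true or false formula expresses it. *)
Lemma fo_const {n} (Q : Prop) : fo Good (n := n) (fun _ _ => Q).
Proof.
  assert (T : fo Good (n := n) (fun _ _ => True)).
  { exists 0, [], (f_all (f_eq Fin.F1 Fin.F1)); split; [constructor|].
    intros; simpl; tauto. }
  destruct (classic Q) as [H|H].
  - apply fo_iff with (2 := T); tauto.
  - apply fo_iff with (fun _ _ => ~ True); [tauto|now apply fo_not].
Qed.

Lemma fo_eq_nth {n} (i j : Fin.t n) : fo Good (fun X v => nth v i = nth v j).
Proof. exists 0, [], (f_eq i j); split; [constructor|]; reflexivity. Qed.

Lemma fo_mem_nth {n} (i j : Fin.t n) : fo Good (fun X v => nth v i ∈ nth v j).
Proof. exists 0, [], (f_mem i j); split; [constructor|]; reflexivity. Qed.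

Lemma fo_X_nth {n} (i : Fin.t n) : fo Good (fun X v => X (nth v i)).
Proof. exists 0, [], (f_in i Fin.F1); split; [constructor|]; reflexivity. Qed.

Lemma fo_class_nth {n} (A : M -> Prop) (i : Fin.t n) :
  Good A -> fo Good (fun X v => A (nth v i)).
Proof.
  intros H; exists 1, [A], (f_in i (Fin.FS Fin.F1)); split; [|reflexivity].
  repeat constructor; exact H.
Qed.

Lemma fo_rename {n n'} (P : (M -> Prop) -> Vector.t M n -> Prop)
    (is : Vector.t (Fin.t n') n) :
  fo Good P -> fo Good (fun X v => P X (map (nth v) is)).
Proof.
  intros (c & K & p & HK & Hp); exists c, K, (rename_vars is p); split; [easy|].
  intros X v; rewrite sat_rename_vars; apply Hp.
Qed.

Fixpoint all_vars (n : nat) : Vector.t (Fin.t n) n :=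
  match n with 0 => [] | S n => Fin.F1 :: map Fin.FS (all_vars n) end.

Lemma map_all_vars {n} (v : Vector.t M n) :
  map (fun i => nth v i) (all_vars n) = v.
Proof.
  induction v; simpl; [easy|]; rewrite map_map; simpl; now f_equal.
Qed.

Lemma fo_term_weaken {n} (t : (M -> Prop) -> Vector.t M n -> M) :
  fo_term Good t -> fo_term Good (n := S n) (fun X v => t X (tl v)).
Proof.
  intros H; unfold fo_term.
  apply fo_iff with (2 := fo_rename (n' := S (S n)) _
    (Fin.F1 :: map (fun i => Fin.FS (Fin.FS i)) (all_vars n)) H).
  intros X v; rewrite (eta v), (eta (tl v)); simpl; rewrite map_map; simpl.
  now rewrite (map_all_vars (tl (tl v))).
Qed.

(** The formulas have no function symbols, so P(t) is expressed as ∃y (y = t ∧ P(y)), using the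
    graph of [t]. *)
Lemma fo_subst {n} (t : (M -> Prop) -> Vector.t M n -> M)
    (P : (M -> Prop) -> Vector.t M n -> M -> Prop) :
  fo_term Good t -> fo Good (n := S n) (fun X v => P X (tl v) (hd v)) ->
  fo Good (fun X v => P X v (t X v)).
Proof.
  intros Ht HP; apply fo_iff with (fun X v => exists y, y = t X v /\ P X v y).
  - intros X v; split; [now intros (y & -> & H)|eauto].
  - apply fo_ex, fo_and; [exact Ht|exact HP].
Qed.

Lemma fo_term_nth {n} (i : Fin.t n) : fo_term Good (fun X v => nth v i).
Proof.
  unfold fo_term; apply fo_iff with (2 := fo_eq_nth Fin.F1 (Fin.FS i)).
  intros X v; now rewrite (eta v).
Qed.

Lemma fo_term_hd {n} : fo_term Good (n := S n) (fun X v => hd v).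
Proof.
  unfold fo_term; apply fo_iff with (2 := fo_eq_nth Fin.F1 (Fin.FS Fin.F1)).
  intros X v; now rewrite (eta v), (eta (tl v)).
Qed.

Lemma fo_term_const {n} (a : M) :
  Good (fun x => x = a) -> fo_term Good (n := n) (fun X v => a).
Proof.
  intros H; unfold fo_term; apply fo_iff with (2 := fo_class_nth _ Fin.F1 H).
  intros X v; now rewrite (eta v).
Qed.

Section Instances.
Context {n : nat} (t t' t'' : (M -> Prop) -> Vector.t M n -> M).
Hypothesis Ht : fo_term Good t.
Hypothesis Ht' : fo_term Good t'.
Hypothesis Ht'' : fo_term Good t''.

Lemma fo_inst1 (R : (M -> Prop) -> M -> Prop) :
  fo Good (n := 1) (fun X v => R X (hd v)) -> fo Good (fun X v => R X (t X v)).
Proof.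
  intros H; apply (fo_subst t (fun X v y => R X y)); [exact Ht|].
  apply fo_iff with (2 := fo_rename (n' := S n) _ [Fin.F1] H).
  intros X v; now rewrite (eta v).
Qed.

Lemma fo_inst2 (R : (M -> Prop) -> M -> M -> Prop) :
  fo Good (n := 2) (fun X v => R X (hd v) (hd (tl v))) ->
  fo Good (fun X v => R X (t X v) (t' X v)).
Proof.
  intros H; apply (fo_subst t (fun X v y => R X y (t' X v))); [exact Ht|].
  apply (fo_subst (fun X v => t' X (tl v)) (fun X v y => R X (hd v) y)).
  { now apply fo_term_weaken. }
  apply fo_iff with (2 := fo_rename (n' := S (S n)) _ [Fin.FS Fin.F1; Fin.F1] H).
  intros X v; now rewrite (eta v), (eta (tl v)).
Qed.

Lemma fo_inst3 (R : (M -> Prop) -> M -> M -> M -> Prop) :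
  fo Good (n := 3) (fun X v => R X (hd v) (hd (tl v)) (hd (tl (tl v)))) ->
  fo Good (fun X v => R X (t X v) (t' X v) (t'' X v)).
Proof.
  intros H; apply (fo_subst t (fun X v y => R X y (t' X v) (t'' X v))); [exact Ht|].
  apply (fo_subst (fun X v => t' X (tl v)) (fun X v y => R X (hd v) y (t'' X (tl v)))).
  { now apply fo_term_weaken. }
  apply (fo_subst (fun X v => t'' X (tl (tl v)))
    (fun X v y => R X (hd (tl v)) (hd v) y)).
  { now apply (fo_term_weaken (fun X v => t'' X (tl v))), fo_term_weaken. }
  apply fo_iff with (2 := fo_rename (n' := S (S (S n))) _
    [Fin.FS (Fin.FS Fin.F1); Fin.FS Fin.F1; Fin.F1] H).
  intros X v; now rewrite (eta v), (eta (tl v)), (eta (tl (tl v))).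
Qed.
End Instances.
End Definability.

Arguments fo {M} Good {n} P.
Arguments fo_term {M} Good {n} t.

Existing Class GBC.

Section Atoms.
Context {M : gb_structure} {Good : (M -> Prop) -> Prop}.

Lemma fo_eq : fo Good (n := 2) (fun X v => hd v = hd (tl v)).
Proof.
  apply fo_iff with (2 := fo_eq_nth Fin.F1 (Fin.FS Fin.F1)).
  intros X v; now rewrite (eta v), (eta (tl v)).
Qed.

Lemma fo_mem : fo Good (n := 2) (fun X v => hd v ∈ hd (tl v)).
Proof.
  apply fo_iff with (2 := fo_mem_nth Fin.F1 (Fin.FS Fin.F1)).
  intros X v; now rewrite (eta v), (eta (tl v)).
Qed.

Lemma fo_X : fo Good (n := 1) (fun X v => X (hd v)).
Proof.
  apply fo_iff with (2 := fo_X_nth Fin.F1).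
  intros X v; now rewrite (eta v).
Qed.

Lemma fo_class (A : M -> Prop) : Good A -> fo Good (n := 1) (fun X v => A (hd v)).
Proof.
  intros H; apply fo_iff with (2 := fo_class_nth A Fin.F1 H).
  intros X v; now rewrite (eta v).
Qed.

Lemma fo_term_inst1 {n} (f : M -> M) (t : (M -> Prop) -> Vector.t M n -> M) :
  fo_term Good (n := 1) (fun X v => f (hd v)) -> fo_term Good t ->
  fo_term Good (fun X v => f (t X v)).
Proof.
  intros Hf Ht; unfold fo_term.
  apply (fo_inst2 _ _ fo_term_hd (fo_term_weaken _ Ht) (fun X x y => x = f y)).
  exact Hf.
Qed.

Lemma fo_term_inst2 {n} (f : M -> M -> M) (t t' : (M -> Prop) -> Vector.t M n -> M) :
  fo_term Good (n := 2) (fun X v => f (hd v) (hd (tl v))) ->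
  fo_term Good t -> fo_term Good t' ->
  fo_term Good (fun X v => f (t X v) (t' X v)).
Proof.
  intros Hf Ht Ht'; unfold fo_term.
  apply (fo_inst3 _ _ _ fo_term_hd (fo_term_weaken _ Ht) (fo_term_weaken _ Ht')
    (fun X x y z => x = f y z)).
  exact Hf.
Qed.

Lemma fo_term_closed {n} (t : M) :
  fo_term Good (n := 0) (fun X v => t) -> fo_term Good (n := n) (fun X v => t).
Proof.
  intros H; induction n; [exact H|].
  exact (fo_term_weaken (fun X v => t) IHn).
Qed.

(** With [eq A] as the condition on parameters, all of them are [A] itself, so they collapse into
    the single class variable 1 allowed in a recursion. This is why [fo] keeps track of its
    parameters. *)
Lemma fo_formula (A : M -> Prop) (P : (M -> Prop) -> Vector.t M 1 -> Prop) :
  fo (eq A) P -> exists phi : formula 2 1,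
    forall X v, sat [X; A] phi v <-> P X v.
Proof.
  intros (c & K & p & HK & Hp).
  exists (rename_classes (fun k => Fin.caseS' k (fun _ => Fin.t 2)
    Fin.F1 (fun _ => Fin.FS Fin.F1)) p).
  intros X v; rewrite Hp; apply sat_rename_classes.
  intros k; apply (Fin.caseS' k); simpl; [easy|]; intros j.
  rewrite Forall_nth in HK; apply HK.
Qed.

(** This and the next two restate the definition of [fo_term], so that they stay usable once
    [fo_term] is made opaque. *)
Lemma fo_term_graph0 (a : M) :
  fo Good (n := 1) (fun X v => hd v = a) -> fo_term Good (n := 0) (fun X v => a).
Proof. easy. Qed.

Lemma fo_term_graph1 (f : M -> M) :
  fo Good (n := 2) (fun X v => hd v = f (hd (tl v))) ->
  fo_term Good (n := 1) (fun X v => f (hd v)).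
Proof. easy. Qed.

Lemma fo_term_graph2 (f : M -> M -> M) :
  fo Good (n := 3) (fun X v => hd v = f (hd (tl v)) (hd (tl (tl v)))) ->
  fo_term Good (n := 2) (fun X v => f (hd v) (hd (tl v))).
Proof. easy. Qed.
End Atoms.

Create HintDb fo discriminated.
#[export] Hint Resolve fo_eq fo_mem fo_X fo_class : fo.

Ltac fo_side := solve [eauto 6 with fo].

Ltac fo_term_tac :=
  cbv beta;
  first
  [ apply fo_term_hd
  | match goal with |- fo_term _ (fun X v => ?a) =>
      first [apply (fo_term_const a); fo_side | apply (fo_term_closed a); fo_side]
    end
  | match goal with
    | |- fo_term _ (fun X v => ?f (@?a X v) (@?b X v)) =>
        apply (fo_term_inst2 f a b); [fo_side|fo_term_tac|fo_term_tac]
    | |- fo_term _ (fun X v => ?f (@?a X v)) =>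
        apply (fo_term_inst1 f a); [fo_side|fo_term_tac]
    end
  | lazymatch goal with
    | |- fo_term _ (fun X v => hd (tl v)) =>
        apply (fo_term_weaken (fun X v => hd v)); fo_term_tac
    | |- fo_term _ (fun X v => hd (tl (tl v))) =>
        apply (fo_term_weaken (fun X v => hd (tl v))); fo_term_tac
    | |- fo_term _ (fun X v => hd (tl (tl (tl v)))) =>
        apply (fo_term_weaken (fun X v => hd (tl (tl v)))); fo_term_tac
    | |- fo_term _ (fun X v => hd (tl (tl (tl (tl v))))) =>
        apply (fo_term_weaken (fun X v => hd (tl (tl (tl v))))); fo_term_tac
    | |- fo_term _ (fun X v => hd (tl (tl (tl (tl (tl v)))))) =>
        apply (fo_term_weaken (fun X v => hd (tl (tl (tl (tl v)))))); fo_term_tac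
    | |- fo_term _ (fun X v => hd (tl (tl (tl (tl (tl (tl v))))))) =>
        apply (fo_term_weaken (fun X v => hd (tl (tl (tl (tl (tl v))))))); fo_term_tac
    | |- fo_term _ (fun X v => hd (tl (tl (tl (tl (tl (tl (tl v)))))))) =>
        apply (fo_term_weaken (fun X v => hd (tl (tl (tl (tl (tl (tl v)))))))); fo_term_tac
    end ].

Ltac fo_unfold :=
  progress cbv beta delta [related functional elems is_adjoin is_empty is_upair is_succ].

(** Follows the syntax of the predicate. A product whose variable does not occur may be an
    implication or a vacuous quantifier, so both are tried. Remaining predicates of at most three
    arguments are looked up among the hints, and a few basic notions are unfolded if that fails. *)
Ltac fo_tac :=
  cbv beta;
  lazymatch goal with
  | |- fo_term _ _ => fo_term_tac
  | |- fo _ (fun X v => ~ @?P X v) => apply (fo_not P); fo_tac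
  | |- fo _ (fun X v => @?P X v /\ @?Q X v) => apply (fo_and P Q); fo_tac
  | |- fo _ (fun X v => @?P X v \/ @?Q X v) => apply (fo_or P Q); fo_tac
  | |- fo _ (fun X v => @?P X v <-> @?Q X v) => apply (fo_iff_conn P Q); fo_tac
  | |- fo _ (fun X v => exists x, @?P X v x) => apply (fo_ex P); fo_tac
  | |- fo _ (fun X v => @?P X v -> @?Q X v) =>
      first [apply (fo_imp P Q) | apply (fo_all (fun X v _ => Q X v))]; fo_tac
  | |- fo _ (fun X v => forall x, @?P X v x) => apply (fo_all P); fo_tac
  | |- fo _ (fun X v => @?a X v = @?b X v) =>
      apply (fo_inst2 a b) with (R := fun _ x y => x = y);
        [fo_term_tac|fo_term_tac|apply fo_eq]
  | |- fo _ (fun X v => @?a X v ∈ @?b X v) =>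
      apply (fo_inst2 a b) with (R := fun _ x y => x ∈ y);
        [fo_term_tac|fo_term_tac|apply fo_mem]
  | |- _ => first
    [ match goal with |- fo _ (fun X v => ?Q) => apply (fo_const Q) end
    | match goal with
      | |- fo _ (fun X v => X (@?a X v)) =>
          apply (fo_inst1 a) with (R := fun X x => X x); [fo_term_tac|apply fo_X]
      | |- fo _ (fun X v => ?Q (@?a X v) (@?b X v) (@?c X v)) =>
          apply (fo_inst3 a b c) with (R := fun _ => Q);
            [fo_term_tac|fo_term_tac|fo_term_tac|fo_side]
      | |- fo _ (fun X v => ?Q (@?a X v) (@?b X v)) =>
          apply (fo_inst2 a b) with (R := fun _ => Q);
            [fo_term_tac|fo_term_tac|fo_side]
      | |- fo _ (fun X v => ?Q (@?a X v)) =>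
          apply (fo_inst1 a) with (R := fun _ => Q); [fo_term_tac|fo_side]
      end
    | fo_unfold; fo_tac ]
  end.

(** * Elementary set theory *)

Section Sets.
Context {M : gb_structure} {HM : GBC M}.
Implicit Types x y z a b : M.

Lemma set_ext x y : (forall z, z ∈ x <-> z ∈ y) -> x = y.
Proof. apply (gbc_extensionality HM). Qed.

Lemma class_ext (P Q : M -> Prop) : (forall x, P x <-> Q x) -> P = Q.
Proof.
  intros H; apply functional_extensionality; intros x.
  apply propositional_extensionality, H.
Qed.

(** Comprehension has no distinguished class variable, so [X] is filled with the empty class, which
    comprehension itself must first supply. *)
Lemma is_class_fo (P : M -> Prop) :
  fo (@is_class M) (n := 1) (fun X v => P (hd v)) -> is_class P.
Proof.
  intros (c & K & p & HK & Hp).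
  pose (E := fun _ : M => False).
  assert (HE : is_class E).
  { replace E with (fun x : M => sat (c := 0) (n := 1) [] (f_neg (f_eq Fin.F1 Fin.F1)) [x]).
    - apply (gbc_comprehension HM (c := 0) (n := 0)); constructor.
    - apply class_ext; unfold E; simpl; tauto. }
  replace P with (fun x => sat (E :: K) p [x]).
  - apply (gbc_comprehension HM (n := 0)); now constructor.
  - apply class_ext; intros x; symmetry; apply (Hp E [x]).
Qed.

Lemma is_class_singleton a : is_class (fun x => x = a).
Proof.
  replace (fun x => x = a) with
    (fun x : M => sat (c := 0) (n := 2) [] (f_eq Fin.F1 (Fin.FS Fin.F1)) [x; a]).
  - apply (gbc_comprehension HM (c := 0) (n := 1)); constructor.
  - apply class_ext; reflexivity.
Qed.

Lemma inhabited_M : inhabited M.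
Proof. destruct (gbc_infinity HM) as (u & _); exact (inhabits u). Qed.

(** Turns set operations into functions of the metatheory. Extensionality makes their values unique,
    so their graphs remain first-order definable. *)
Definition the (P : M -> Prop) : M := epsilon inhabited_M P.

Lemma the_spec (P : M -> Prop) : (exists x, P x) -> P (the P).
Proof. apply epsilon_spec. Qed.

Definition upair x y : M := the (fun z => is_upair z x y).
Definition sing x : M := upair x x.
Definition opair x y : M := upair (sing x) (upair x y).
Definition bigcup x : M := the (fun u => forall z, z ∈ u <-> exists y, y ∈ x /\ z ∈ y).
Definition adjoin y x : M := bigcup (upair y (sing x)).
Definition succ x : M := adjoin x x.
Definition image (F : M -> M) a : M :=
  the (fun b => forall y, y ∈ b <-> exists x, x ∈ a /\ y = F x).

Lemma in_upair w x y : w ∈ upair x y <-> w = x \/ w = y.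
Proof. apply (the_spec _ (gbc_pairing HM x y)). Qed.

Lemma in_sing w x : w ∈ sing x <-> w = x.
Proof. unfold sing; rewrite in_upair; tauto. Qed.

Lemma in_bigcup z x : z ∈ bigcup x <-> exists y, y ∈ x /\ z ∈ y.
Proof. apply (the_spec _ (gbc_union HM x)). Qed.

Lemma in_adjoin w y x : w ∈ adjoin y x <-> w ∈ y \/ w = x.
Proof.
  unfold adjoin; rewrite in_bigcup; split.
  - intros (u & [->| ->]%in_upair & H); [now left|right; now apply in_sing].
  - intros [H|H]; [exists y|exists (sing x)]; rewrite in_upair, ?in_sing; tauto.
Qed.

Lemma in_succ w x : w ∈ succ x <-> w ∈ x \/ w = x.
Proof. apply in_adjoin. Qed.

Lemma is_upair_eq z x y : is_upair z x y <-> z = upair x y.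
Proof.
  split.
  - intros H; apply set_ext; intros w; rewrite in_upair; apply H.
  - intros -> w; apply in_upair.
Qed.

Lemma is_opair_eq z x y : is_opair z x y <-> z = opair x y.
Proof.
  unfold is_opair; setoid_rewrite is_upair_eq; split.
  - intros (a & b & -> & -> & ->); reflexivity.
  - intros ->; exists (upair x x), (upair x y); auto.
Qed.

Lemma is_adjoin_eq z y x : is_adjoin z y x <-> z = adjoin y x.
Proof.
  split.
  - intros H; apply set_ext; intros w; rewrite in_adjoin; apply H.
  - intros -> w; apply in_adjoin.
Qed.

Lemma is_succ_eq z y : is_succ z y <-> z = succ y.
Proof. apply is_adjoin_eq. Qed.

Lemma related_eq (R : M -> Prop) x y : related R x y <-> R (opair x y).
Proof.
  unfold related; setoid_rewrite is_opair_eq; split.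
  - now intros (p & -> & H).
  - eauto.
Qed.

Lemma sing_inj x y : sing x = sing y -> x = y.
Proof. intros H; apply in_sing; rewrite <- H; now apply in_sing. Qed.

Lemma opair_inj x y x' y' : opair x y = opair x' y' -> x = x' /\ y = y'.
Proof.
  intros H.
  assert (E : x = x').
  { assert (K : sing x ∈ opair x' y') by (rewrite <- H; apply in_upair; auto).
    apply in_upair in K as [K|K]; [now apply sing_inj|].
    symmetry; apply in_sing; rewrite K; apply in_upair; auto. }
  subst x'; split; [easy|].
  assert (K : upair x y ∈ opair x y') by (rewrite <- H; apply in_upair; auto).
  assert (K' : upair x y' ∈ opair x y) by (rewrite H; apply in_upair; auto).
  assert (L : y = x \/ y = y').
  { apply in_upair in K as [K|K]; [left; apply in_sing|right].
    - rewrite <- K; apply in_upair; auto.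
    - assert (J : y ∈ upair x y') by (rewrite <- K; apply in_upair; auto).
      assert (J' : y' ∈ upair x y) by (rewrite K; apply in_upair; auto).
      apply in_upair in J, J'; intuition congruence. }
  assert (L' : y' = x \/ y = y').
  { apply in_upair in K' as [K'|K']; [left; apply in_sing|right].
    - rewrite <- K'; apply in_upair; auto.
    - assert (J : y ∈ upair x y') by (rewrite K'; apply in_upair; auto).
      assert (J' : y' ∈ upair x y) by (rewrite <- K'; apply in_upair; auto).
      apply in_upair in J, J'; intuition congruence. }
  intuition congruence.
Qed.
End Sets.

#[export] Hint Resolve is_class_singleton : fo.
#[global] Opaque fo fo_term.

Section TermsFO.
Context {M : gb_structure} {HM : GBC M} {Good : (M -> Prop) -> Prop}.

Lemma fo_upair : fo_term Good (n := 2) (fun X v => upair (hd v) (hd (tl v))).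
Proof.
  apply fo_term_graph2, fo_iff with
    (fun X v => is_upair (hd v) (hd (tl v)) (hd (tl (tl v)))).
  - intros X v; apply is_upair_eq.
  - fo_tac.
Qed.
Hint Resolve fo_upair : fo.

Lemma fo_sing : fo_term Good (n := 1) (fun X v => sing (hd v)).
Proof. unfold sing; fo_tac. Qed.
Hint Resolve fo_sing : fo.

Lemma fo_opair : fo_term Good (n := 2) (fun X v => opair (hd v) (hd (tl v))).
Proof. unfold opair; fo_tac. Qed.

Lemma fo_bigcup : fo_term Good (n := 1) (fun X v => bigcup (hd v)).
Proof.
  apply fo_term_graph1, fo_iff with
    (fun X v => forall z, z ∈ hd v <-> exists y, y ∈ hd (tl v) /\ z ∈ y).
  - intros X v; setoid_rewrite <- in_bigcup; split; [apply set_ext|now intros ->].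
  - fo_tac.
Qed.
Hint Resolve fo_bigcup : fo.

Lemma fo_adjoin : fo_term Good (n := 2) (fun X v => adjoin (hd v) (hd (tl v))).
Proof. unfold adjoin; fo_tac. Qed.
Hint Resolve fo_adjoin : fo.

Lemma fo_succ : fo_term Good (n := 1) (fun X v => succ (hd v)).
Proof. unfold succ; fo_tac. Qed.

Lemma fo_is_opair :
  fo Good (n := 3) (fun X v => is_opair (hd v) (hd (tl v)) (hd (tl (tl v)))).
Proof. unfold is_opair; fo_tac. Qed.
End TermsFO.
#[export] Hint Resolve fo_upair fo_sing fo_opair fo_bigcup fo_adjoin fo_succ fo_is_opair : fo.

Ltac solve_class := apply is_class_fo; fo_tac.

(** * Replacement, induction along membership, numerals *)

Section Replacement.
Context {M : gb_structure} {HM : GBC M}.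
Implicit Types x y z a b : M.

Lemma replacement (R : M -> M -> Prop) a :
  fo (@is_class M) (n := 2) (fun X v => R (hd v) (hd (tl v))) ->
  (forall x y z, R x y -> R x z -> y = z) ->
  exists b, forall y, y ∈ b <-> exists x, x ∈ a /\ R x y.
Proof.
  intros HR U.
  destruct (gbc_replacement HM (F := fun p => exists x y, p = opair x y /\ R x y))
    with (a := a) as (b & Hb).
  - solve_class.
  - intros x y z; rewrite !related_eq.
    intros (x1 & y1 & E1 & H1) (x2 & y2 & E2 & H2).
    apply opair_inj in E1 as [-> ->]; apply opair_inj in E2 as [-> ->].
    eapply U; eauto.
  - exists b; intros y; rewrite Hb; setoid_rewrite related_eq.
    split; intros (x & Hx & H); exists x; split; auto.
    + destruct H as (x1 & y1 & E1 & H1); now apply opair_inj in E1 as [-> ->].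
    + eauto.
Qed.

Lemma separation (P : M -> Prop) a :
  is_class P -> exists b, forall y, y ∈ b <-> y ∈ a /\ P y.
Proof.
  intros HP; destruct (replacement (fun x y => x = y /\ P x) a) as (b & Hb).
  - fo_tac.
  - intros x y z [-> _] [-> _]; reflexivity.
  - exists b; intros y; rewrite Hb; split.
    + now intros (x & H & -> & H').
    + intros [H H']; eauto.
Qed.

Lemma in_image (F : M -> M) a y :
  fo_term (@is_class M) (n := 1) (fun X v => F (hd v)) ->
  y ∈ image F a <-> exists x, x ∈ a /\ y = F x.
Proof.
  intros HF; apply (the_spec (fun b => forall y, y ∈ b <-> exists x, x ∈ a /\ y = F x)).
  apply (replacement (fun x y => y = F x)); [fo_tac|congruence].
Qed.

Lemma fo_image (F : M -> M) :
  fo_term (@is_class M) (n := 1) (fun X v => F (hd v)) ->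
  fo_term (@is_class M) (n := 1) (fun X v => image F (hd v)).
Proof.
  intros HF; apply fo_term_graph1, fo_iff with
    (fun X v => forall y, y ∈ hd v <-> exists x, x ∈ hd (tl v) /\ y = F x).
  - intros X v; setoid_rewrite <- (fun a y => in_image F a y HF).
    split; [apply set_ext|now intros ->].
  - fo_tac.
Qed.

Lemma mem_induction (P : M -> Prop) :
  is_class P -> (forall x, (forall y, y ∈ x -> P y) -> P x) -> forall x, P x.
Proof.
  intros HP H x; apply NNPP; intros Nx.
  destruct (gbc_foundation HM (X := fun x => ~ P x)) as (z & Hz & Hm).
  - solve_class.
  - now exists x.
  - apply Hz, H; intros y Hy; apply NNPP; intros Ny; exact (Hm y Hy Ny).
Qed.

(* The transitive closure of a set need not be at hand: codes of formulas are
   at most four levels above their immediate subformulas. *)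
Lemma deep_induction (P : M -> Prop) :
  is_class P ->
  (forall x,
    (forall y z1, z1 ∈ x -> (y = z1 \/ y ∈ z1 \/ (exists z2, z2 ∈ z1 /\
      (y ∈ z2 \/ exists z3, z3 ∈ z2 /\ y ∈ z3))) -> P y) -> P x) ->
  forall x, P x.
Proof.
  intros HP H x.
  (* A plain induction along [∈] proves [P] for [x] and for everything down to three levels inside
     it, which is as far as [H] looks below an element of its argument. *)
  cut (P x /\ (forall y, y ∈ x -> P y) /\
    (forall y z, z ∈ x -> y ∈ z -> P y) /\
    (forall y z w, w ∈ x -> z ∈ w -> y ∈ z -> P y)); [tauto|].
  revert x; apply mem_induction.
  - solve_class.
  - intros x IH; split; [apply H|split; [|split]].
    + intros y z1 Hz1 C; destruct (IH z1 Hz1) as (I1 & I2 & I3 & I4).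
      destruct C as [->|[C|(z2 & Hz2 & [C|(z3 & Hz3 & C)])]]; eauto.
    + intros y Hy; exact (proj1 (IH y Hy)).
    + intros y z Hz Hy; destruct (IH z Hz) as (I1 & I2 & I3 & I4); eauto.
    + intros y z w Hw Hz Hy; destruct (IH w Hw) as (I1 & I2 & I3 & I4); eauto.
Qed.

Lemma mem_irrefl x : ~ x ∈ x.
Proof.
  revert x; apply mem_induction; [solve_class|].
  intros x IH H; exact (IH x H H).
Qed.

Lemma mem_no_2cycle x y : x ∈ y -> y ∈ x -> False.
Proof.
  revert y; revert x.
  apply (mem_induction (fun x => forall y, x ∈ y -> y ∈ x -> False)); [solve_class|].
  intros x IH y H1 H2; exact (IH y H2 x H2 H1).
Qed.

Lemma mem_no_3cycle x y z : x ∈ y -> y ∈ z -> z ∈ x -> False.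
Proof.
  revert y z; revert x.
  apply (mem_induction (fun x => forall y z, x ∈ y -> y ∈ z -> z ∈ x -> False));
    [solve_class|].
  intros x IH y z H1 H2 H3; exact (IH z H3 x y H3 H1 H2).
Qed.

Definition emp : M := the is_empty.

Lemma not_in_emp x : ~ x ∈ emp.
Proof.
  revert x; apply (the_spec is_empty).
  destruct (gbc_infinity HM) as (u & (e & He & _) & _); now exists e.
Qed.

Lemma emp_eq x : (forall y, ~ y ∈ x) -> x = emp.
Proof.
  intros H; apply set_ext; intros z; split; intros K.
  - now apply H in K.
  - now apply not_in_emp in K.
Qed.

Lemma opair_not_emp x y : opair x y <> emp.
Proof.
  intros H; apply (not_in_emp (sing x)); rewrite <- H; apply in_upair; auto.
Qed.

Lemma is_empty_eq x : is_empty x <-> x = emp.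
Proof. split; [apply emp_eq|intros -> w; apply not_in_emp]. Qed.

(* Behind an opaque proof, so that unification does not try to tell numerals
   apart by unfolding them. *)
Lemma num_sig : {f : nat -> M | f 0 = emp /\ forall k, f (S k) = succ (f k)}.
Proof.
  exists (fix num k := match k with 0 => emp | S k => succ (num k) end); auto.
Qed.

Definition num : nat -> M := proj1_sig num_sig.

Lemma num_0 : num 0 = emp.
Proof. apply (proj2_sig num_sig). Qed.

Lemma num_S k : num (S k) = succ (num k).
Proof. apply (proj2_sig num_sig). Qed.

Lemma is_numeral_eq k z : is_numeral k z <-> z = num k.
Proof.
  revert z; induction k; intros z; rewrite ?num_0, ?num_S; simpl; [apply is_empty_eq|].
  setoid_rewrite is_succ_eq; setoid_rewrite IHk; split.
  - now intros (y & -> & ->).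
  - eauto.
Qed.

Lemma succ_inj x y : succ x = succ y -> x = y.
Proof.
  intros H.
  assert (K : x ∈ succ y) by (rewrite <- H; apply in_succ; auto).
  assert (K' : y ∈ succ x) by (rewrite H; apply in_succ; auto).
  apply in_succ in K as [K|K], K' as [K'|K']; auto.
  now destruct (mem_no_2cycle x y).
Qed.

Lemma succ_not_emp x : succ x <> emp.
Proof. intros H; apply (not_in_emp x); rewrite <- H; apply in_succ; auto. Qed.

Lemma num_inj j k : num j = num k -> j = k.
Proof.
  revert k; induction j; intros [|k] H; rewrite ?num_0, ?num_S in H; auto.
  - symmetry in H; now apply succ_not_emp in H.
  - now apply succ_not_emp in H.
  - now apply succ_inj, IHj in H as ->.
Qed.
End Replacement.

Section EmpFO.
Context {M : gb_structure} {HM : GBC M} {Good : (M -> Prop) -> Prop}.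

Lemma fo_emp : fo_term Good (n := 0) (fun X v => emp).
Proof.
  apply fo_term_graph0, fo_iff with (fun X v => is_empty (hd v)).
  - intros X v; apply is_empty_eq.
  - fo_tac.
Qed.

Lemma fo_num k : fo_term Good (n := 0) (fun X v => num k).
Proof.
  induction k; [rewrite num_0; apply fo_emp|]; rewrite num_S.
  apply (fo_term_inst1 succ (fun X v => num k)); [fo_side|exact IHk].
Qed.

End EmpFO.
#[export] Hint Resolve fo_image fo_emp fo_num : fo.

(** * Ordinals and recursion *)

Lemma fo_Ord {M : gb_structure} {Good : (M -> Prop) -> Prop} :
  fo Good (n := 1) (fun X v => Ord (hd v)).
Proof. unfold Ord; fo_tac. Qed.
#[export] Hint Resolve fo_Ord : fo.

Section Ordinals.
Context {M : gb_structure} {HM : GBC M}.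
Implicit Types x y z a b : M.

Lemma is_class_Ord : is_class (@Ord M).
Proof. solve_class. Qed.

Lemma is_class_elems a : is_class (elems a).
Proof. solve_class. Qed.

(** Foundation for the class of elements of [s] supplies the minimal element, so transitivity and
    linearity suffice. *)
Lemma Ord_intro a :
  (forall x y, x ∈ a -> y ∈ x -> y ∈ a) ->
  (forall x y, x ∈ a -> y ∈ a -> x ∈ y \/ x = y \/ y ∈ x) -> Ord a.
Proof.
  intros H1 H2; split; [exact H1|split; [exact H2|]].
  intros s _ Hs; destruct (gbc_foundation HM (is_class_elems s) Hs) as (x & Hx & K).
  exists x; split; [exact Hx|]; intros y Hy Hyx; exact (K y Hyx Hy).
Qed.

Lemma Ord_trans a x y : Ord a -> x ∈ a -> y ∈ x -> y ∈ a.
Proof. intros [H _]; apply H. Qed.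

Lemma Ord_elem a b : Ord a -> b ∈ a -> Ord b.
Proof.
  intros Ha Hb; assert (Ht := fun x y => Ord_trans a x y Ha).
  destruct Ha as (_ & H2 & _); apply Ord_intro.
  - intros x y Hx Hy; destruct (H2 y b) as [H|[H|H]]; eauto.
    + subst y; now destruct (mem_no_2cycle x b).
    + now destruct (mem_no_3cycle x b y).
  - eauto.
Qed.

(** Induction on [a] and, inside it, on [b]. If no element of [b] reaches [a] and no element of [a]
    reaches [b], the hypotheses leave only that each is included in the other. *)
Lemma Ord_trichotomy a b : Ord a -> Ord b -> a ∈ b \/ a = b \/ b ∈ a.
Proof.
  intros Ha; revert b; revert a Ha.
  apply (mem_induction (fun a => Ord a -> forall b, Ord b -> a ∈ b \/ a = b \/ b ∈ a));
    [solve_class|].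
  intros a IHa Ha; apply (mem_induction (fun b => Ord b -> a ∈ b \/ a = b \/ b ∈ a));
    [solve_class|].
  intros b IHb Hb.
  destruct (classic (exists y, y ∈ b /\ (a ∈ y \/ a = y))) as [(y & Hy & [H| ->])|N];
    [left; eapply Ord_trans; eauto|now left|].
  destruct (classic (exists x, x ∈ a /\ (b ∈ x \/ b = x))) as [(x & Hx & [H| ->])|N'];
    [right; right; eapply Ord_trans; eauto|now right; right|].
  right; left; apply set_ext; intros z; split; intros Hz.
  - destruct (IHa z Hz (Ord_elem _ _ Ha Hz) b Hb) as [H|[<-|H]]; auto;
      destruct N'; eauto.
  - destruct (IHb z Hz (Ord_elem _ _ Hb Hz)) as [H|[->|H]]; auto;
      destruct N; eauto.
Qed.

Lemma Ord_emp : Ord emp.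
Proof. apply Ord_intro; intros x y H; now apply not_in_emp in H. Qed.

Lemma Ord_succ a : Ord a -> Ord (succ a).
Proof.
  intros Ha; apply Ord_intro.
  - intros x y [Hx| ->]%in_succ Hy; apply in_succ; left; [|exact Hy].
    eapply Ord_trans; eauto.
  - intros x y Hx%in_succ Hy%in_succ; apply Ord_trichotomy.
    + destruct Hx as [Hx| ->]; [eapply Ord_elem; eauto|exact Ha].
    + destruct Hy as [Hy| ->]; [eapply Ord_elem; eauto|exact Ha].
Qed.

Lemma Ord_bigcup a : (forall x, x ∈ a -> Ord x) -> Ord (bigcup a).
Proof.
  intros H; apply Ord_intro.
  - intros x y (z & Hz & Hx)%in_bigcup Hy; apply in_bigcup; exists z.
    split; [easy|]; eapply Ord_trans; eauto.
  - intros x y (z & Hz & Hx)%in_bigcup (w & Hw & Hy)%in_bigcup.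
    apply Ord_trichotomy; [apply (Ord_elem z)|apply (Ord_elem w)]; auto.
Qed.

Lemma Ord_least (P : M -> Prop) b : is_class P -> Ord b -> P b ->
  exists a, Ord a /\ P a /\ forall c, c ∈ a -> ~ P c.
Proof.
  intros HP Hb HPb.
  destruct (gbc_foundation HM (X := fun x => Ord x /\ P x)) as (a & [Ha Ka] & H).
  - solve_class.
  - now exists b.
  - exists a; split; [easy|split; [easy|]]; intros c Hc K.
    apply (H c Hc); split; [eapply Ord_elem; eauto|exact K].
Qed.

(** Passing to the least related ordinal makes the relation functional, so replacement applies; the
    successor of the union lies strictly above all these ordinals. *)
Lemma Ord_bound (R : M -> M -> Prop) a :
  fo (@is_class M) (n := 2) (fun X v => R (hd v) (hd (tl v))) ->
  (forall x, x ∈ a -> exists b, Ord b /\ R x b) ->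
  exists b, Ord b /\ forall x, x ∈ a -> exists c, c ∈ b /\ R x c.
Proof.
  intros HR H.
  destruct (replacement (fun x b => Ord b /\ R x b /\ forall c, c ∈ b -> ~ R x c) a)
    as (s & Hs).
  - fo_tac.
  - intros x b c (Hb & Rb & Mb) (Hc & Rc & Mc).
    destruct (Ord_trichotomy b c Hb Hc) as [K|[K|K]]; auto.
    + now destruct (Mc b K).
    + now destruct (Mb c K).
  - exists (succ (bigcup s)).
    assert (Os : forall x, x ∈ s -> Ord x).
    { intros y (x & _ & Hy & _)%Hs; exact Hy. }
    split; [now apply Ord_succ, Ord_bigcup|].
    intros x Hx; destruct (H x Hx) as (b0 & Hb0 & HR0).
    destruct (Ord_least (R x) b0) as (b & Hb & Rb & Mb); auto.
    { solve_class. }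
    exists b; split; [|exact Rb].
    assert (Hbs : b ∈ s) by (apply Hs; eauto).
    destruct (Ord_trichotomy b (bigcup s)) as [K|[K|K]]; auto.
    { now apply Ord_bigcup. }
    + apply in_succ; auto.
    + apply in_succ; auto.
    + destruct (mem_irrefl (bigcup s)); apply in_bigcup; eauto.
Qed.

Lemma Ord_induction (P : M -> Prop) :
  is_class P -> (forall a, Ord a -> (forall b, b ∈ a -> P b) -> P a) ->
  forall a, Ord a -> P a.
Proof.
  intros HP H; apply (mem_induction (fun a => Ord a -> P a)); [solve_class|].
  intros a IH Ha; apply H; [exact Ha|]; intros b Hb; apply IH; [exact Hb|].
  eapply Ord_elem; eauto.
Qed.

Lemma succ_mem_or_eq a b : Ord a -> b ∈ a -> succ b ∈ a \/ a = succ b.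
Proof.
  intros Ha Hb; assert (Ob := Ord_elem _ _ Ha Hb).
  destruct (Ord_trichotomy (succ b) a) as [H|[H|H]]; auto.
  { now apply Ord_succ. }
  apply in_succ in H as [H|H].
  - now destruct (mem_no_2cycle a b).
  - subst b; now destruct (mem_irrefl a).
Qed.

(** * Recursion along the ordinals *)

Section Recursion.
Context (G : M -> M).
Hypothesis HG : fo_term (@is_class M) (n := 1) (fun X v => G (hd v)).
Hint Resolve HG : fo.

(** A partial solution whose domain contains the elements of its members. [G] receives only the set
    of earlier values, not the function; the stage formulas and the bound on their depth need no
    more. *)
Let attempt f := forall x y, opair x y ∈ f ->
  (forall z, z ∈ x -> exists w, opair z w ∈ f) /\
  exists s, (forall w, w ∈ s <-> exists z, z ∈ x /\ opair z w ∈ f) /\ y = G s.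

Let attempt_unique x y y' f f' : attempt f -> attempt f' ->
  opair x y ∈ f -> opair x y' ∈ f' -> y = y'.
Proof.
  intros A A'; revert y y'; revert x.
  apply (mem_induction (fun x => forall y y', opair x y ∈ f -> opair x y' ∈ f' -> y = y'));
    [solve_class|].
  intros x IH y y' Hy Hy'.
  destruct (A _ _ Hy) as (D & s & Hs & ->), (A' _ _ Hy') as (D' & s' & Hs' & ->).
  f_equal; apply set_ext; intros w; rewrite Hs, Hs'.
  split; intros (z & Hz & Hw); exists z; split; auto.
  - destruct (D' z Hz) as (w' & Hw'); now rewrite (IH z Hz _ _ Hw Hw').
  - destruct (D z Hz) as (w' & Hw'); now rewrite <- (IH z Hz _ _ Hw' Hw).
Qed.

Let value x y := exists f, attempt f /\ opair x y ∈ f.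

Let fo_value : fo (@is_class M) (n := 2) (fun X v => value (hd v) (hd (tl v))).
Proof. unfold value, attempt; fo_tac. Qed.
Hint Resolve fo_value : fo.

(** The values below [a] are unique, so replacement collects them into a function [f], which is
    extended by the value at [a]. Its domain a ∪ {a} is transitive, so no transitive closures are
    needed for recursion on ordinals. *)
Let value_exists a : Ord a -> exists y, value a y.
Proof.
  revert a; apply Ord_induction; [solve_class|].
  intros a Ha IH.
  assert (U : forall x y z, value x y -> value x z -> y = z).
  { intros x y z (f & A & Hy) (f' & A' & Hz); exact (attempt_unique x y z f f' A A' Hy Hz). }
  destruct (replacement (fun x p => exists y, p = opair x y /\ value x y) a)
    as (f & Hf).
  { fo_tac. }
  { intros x p q (y & -> & Hy) (z & -> & Hz); now rewrite (U x y z). }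
  destruct (replacement value a) as (s & Hs); [fo_tac|exact U|].
  assert (Hf' : forall x y, opair x y ∈ f <-> x ∈ a /\ value x y).
  { intros x y; rewrite Hf; split.
    - intros (x' & Hx & y' & [-> ->]%opair_inj & K); auto.
    - intros [Hx K]; exists x; eauto. }
  exists (G s), (adjoin f (opair a (G s))); split; [|apply in_adjoin; auto].
  assert (Hs' : forall x, (forall z, z ∈ x -> z ∈ a) -> forall w,
    (exists z, z ∈ x /\ opair z w ∈ adjoin f (opair a (G s))) <->
    (exists z, z ∈ x /\ value z w)).
  { intros x Hx w; split; intros (z & Hz & K); exists z; split; auto.
    - apply in_adjoin in K as [K|K]; [now apply Hf' in K|].
      apply opair_inj in K as [-> _]; destruct (mem_irrefl a); auto.
    - apply in_adjoin; left; apply Hf'; auto. }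
  intros x y [Hxy|[-> ->]%opair_inj]%in_adjoin.
  - apply Hf' in Hxy as [Hx (f' & A' & K)].
    assert (Sx : forall z, z ∈ x -> z ∈ a) by (intros; eapply Ord_trans; eauto).
    destruct (A' x y K) as (D & t & Ht & E); split.
    + intros z Hz; destruct (D z Hz) as (w & Hw); exists w.
      apply in_adjoin; left; apply Hf'; split; [auto|now exists f'].
    + exists t; split; [|exact E]; intros w; rewrite Ht, (Hs' x Sx).
      split; intros (z & Hz & Hw); exists z; split; auto.
      * now exists f'.
      * destruct (D z Hz) as (w' & Hw'); rewrite (U z w w'); auto; now exists f'.
  - split.
    + intros z Hz; destruct (IH z Hz) as (w & Hw); exists w.
      apply in_adjoin; left; apply Hf'; auto.
    + exists s; split; [|reflexivity]; intros w; rewrite Hs, Hs'; [reflexivity|auto].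
Qed.

Lemma recursion : exists F : M -> M,
  fo_term (@is_class M) (n := 1) (fun X v => F (hd v)) /\
  forall a, Ord a -> F a = G (image F a).
Proof.
  (* The default [emp] off the ordinals makes [F] total with a first-order graph. *)
  set (F := fun a => the (fun y => (Ord a /\ value a y) \/ (~ Ord a /\ y = emp))).
  assert (U : forall x y z, value x y -> value x z -> y = z).
  { intros x y z (f & A & Hy) (f' & A' & Hz); exact (attempt_unique x y z f f' A A' Hy Hz). }
  assert (HF : forall a, (Ord a /\ value a (F a)) \/ (~ Ord a /\ F a = emp)).
  { intros a; unfold F.
    apply (the_spec (fun y => (Ord a /\ value a y) \/ (~ Ord a /\ y = emp))).
    destruct (classic (Ord a)) as [H|H]; [|eauto].
    destruct (value_exists a H); eauto. }
  assert (FO : fo_term (@is_class M) (n := 1) (fun X v => F (hd v))).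
  { apply fo_term_graph1, fo_iff with (fun X v =>
      (Ord (hd (tl v)) /\ value (hd (tl v)) (hd v)) \/ (~ Ord (hd (tl v)) /\ hd v = emp)).
    - intros X v; destruct (HF (hd (tl v))) as [[H K]|[H K]]; split.
      + intros [[_ L]|[L _]]; [eapply U; eauto|easy].
      + intros ->; auto.
      + intros [[L _]|[_ L]]; [easy|congruence].
      + intros L; rewrite K in L; auto.
    - fo_tac. }
  assert (V : forall a, Ord a -> value a (F a)).
  { intros a Ha; now destruct (HF a) as [[_ K]|[K _]]. }
  exists F; split; [exact FO|].
  intros a Ha; destruct (V a Ha) as (f & A & K).
  destruct (A _ _ K) as (D & s & Hs & ->); f_equal.
  apply set_ext; intros w; rewrite Hs, (in_image F a w FO).
  split; intros (z & Hz & Hw); exists z; split; auto.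
  - eapply U; [|apply V; eapply Ord_elem; eauto]; now exists f.
  - subst w; destruct (D z Hz) as (w & Hw).
    rewrite (U z (F z) w); [exact Hw|apply V; eapply Ord_elem; eauto|now exists f].
Qed.
End Recursion.
End Ordinals.
#[export] Hint Resolve is_class_Ord is_class_elems : fo.

(** * Infinitary formulas *)

Section Formulas.
Context {M : gb_structure} {HM : GBC M}.
Implicit Types x y z a b d e f p q r i j s : M.

Definition fEq i j : M := opair (num 0) (opair i j).
Definition fMem i j : M := opair (num 1) (opair i j).
Definition fIn i : M := opair (num 2) i.
Definition fNeg p : M := opair (num 3) p.
Definition fConj Q : M := opair (num 4) Q.
Definition fAll i p : M := opair (num 5) (opair i p).

Lemma is_tagged_eq k z x : is_tagged k z x <-> z = opair (num k) x.
Proof.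
  unfold is_tagged; setoid_rewrite is_numeral_eq; setoid_rewrite is_opair_eq.
  split; [now intros (t & -> & ->)|eauto].
Qed.

Lemma L_eq_eq p i j : L_eq p i j <-> p = fEq i j.
Proof.
  unfold L_eq; setoid_rewrite is_tagged_eq; setoid_rewrite is_opair_eq.
  split; [now intros (t & -> & ->)|intros ->; eexists; split; reflexivity].
Qed.

Lemma L_mem_eq p i j : L_mem p i j <-> p = fMem i j.
Proof.
  unfold L_mem; setoid_rewrite is_tagged_eq; setoid_rewrite is_opair_eq.
  split; [now intros (t & -> & ->)|intros ->; eexists; split; reflexivity].
Qed.

Lemma L_in_eq p i : L_in p i <-> p = fIn i.
Proof. apply is_tagged_eq. Qed.

Lemma L_neg_eq p q : L_neg p q <-> p = fNeg q.
Proof. apply is_tagged_eq. Qed.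

Lemma L_conj_eq p Q : L_conj p Q <-> p = fConj Q.
Proof. apply is_tagged_eq. Qed.

Lemma L_all_eq p i q : L_all p i q <-> p = fAll i q.
Proof.
  unfold L_all; setoid_rewrite is_tagged_eq; setoid_rewrite is_opair_eq.
  split; [now intros (t & -> & ->)|intros ->; eexists; split; reflexivity].
Qed.

(* Equations between relations rewrite under binders. *)
Lemma code_funs :
  (@L_eq M = fun p i j => p = fEq i j) /\ (@L_mem M = fun p i j => p = fMem i j) /\
  (@L_in M = fun p i => p = fIn i) /\ (@L_neg M = fun p q => p = fNeg q) /\
  (@L_conj M = fun p Q => p = fConj Q) /\ (@L_all M = fun p i q => p = fAll i q) /\
  (@related M = fun R x y => R (opair x y)) /\
  (@is_opair M = fun z x y => z = opair x y) /\
  (@is_adjoin M = fun z y x => z = adjoin y x).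
Proof.
  repeat split; repeat (apply functional_extensionality; intros ?);
    apply propositional_extensionality.
  - apply L_eq_eq.
  - apply L_mem_eq.
  - apply L_in_eq.
  - apply L_neg_eq.
  - apply L_conj_eq.
  - apply L_all_eq.
  - apply related_eq.
  - apply is_opair_eq.
  - apply is_adjoin_eq.
Qed.

Lemma tag_inj k l x y : opair (num k) x = opair (num l) y -> k = l /\ x = y.
Proof. intros [H ->]%opair_inj; split; [now apply num_inj|easy]. Qed.
End Formulas.

Ltac tag_cases E :=
  unfold fEq, fMem, fIn, fNeg, fConj, fAll in E;
  let K := fresh in apply tag_inj in E as [K E]; try discriminate K; clear K.

Section Formulas.
Context {M : gb_structure} {HM : GBC M}.
Implicit Types x y z a b d e f p q r i j s : M.

Definition imm q p : Prop :=
  p = fNeg q \/ (exists Q, p = fConj Q /\ q ∈ Q) \/ (exists i, p = fAll i q).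

Lemma imm_eq q p : immediate_subformula q p <-> imm q p.
Proof.
  unfold immediate_subformula, imm.
  now setoid_rewrite L_neg_eq; setoid_rewrite L_conj_eq; setoid_rewrite L_all_eq.
Qed.

Lemma is_fun_eq f d : is_fun f d <->
  (forall p, p ∈ f -> exists x y, x ∈ d /\ p = opair x y) /\
  (forall x, x ∈ d -> exists y, opair x y ∈ f) /\
  (forall x y z, opair x y ∈ f -> opair x z ∈ f -> y = z).
Proof.
  unfold is_fun, functional, elems.
  setoid_rewrite related_eq; setoid_rewrite is_opair_eq; reflexivity.
Qed.

Lemma adjoin_same d i : i ∈ d -> adjoin d i = d.
Proof.
  intros H; apply set_ext; intros z; rewrite in_adjoin; split; [|tauto].
  now intros [K| ->].
Qed.

Lemma is_fun_dom f d x y : is_fun f d -> opair x y ∈ f -> x ∈ d.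
Proof.
  rewrite is_fun_eq; intros (H & _) K.
  destruct (H _ K) as (x' & y' & Hx & E); now apply opair_inj in E as [-> _].
Qed.

Lemma is_fun_uniq f d x y z : is_fun f d -> opair x y ∈ f -> opair x z ∈ f -> y = z.
Proof. rewrite is_fun_eq; intros (_ & _ & H); apply H. Qed.

Lemma is_fun_adjoin f d i y : is_fun f d -> ~ i ∈ d ->
  is_fun (adjoin f (opair i y)) (adjoin d i).
Proof.
  intros Hf Hi; assert (K := is_fun_dom f d); rewrite is_fun_eq in *.
  destruct Hf as (H1 & H2 & H3); split; [|split].
  - intros p [Hp| ->]%in_adjoin.
    + destruct (H1 p Hp) as (x & z & Hx & ->); exists x, z; rewrite in_adjoin; auto.
    + exists i, y; rewrite in_adjoin; auto.
  - intros x [Hx| ->]%in_adjoin.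
    + destruct (H2 x Hx) as (z & Hz); exists z; apply in_adjoin; auto.
    + exists y; apply in_adjoin; auto.
  - intros x z w Hz%in_adjoin Hw%in_adjoin.
    assert (D : forall u, opair x u ∈ f -> x <> i).
    { intros u Hu ->; apply Hi; destruct (H1 _ Hu) as (x' & y' & Hx & E).
      now apply opair_inj in E as [-> _]. }
    destruct Hz as [Hz|[-> ->]%opair_inj].
    + destruct Hw as [Hw|[-> ->]%opair_inj]; [eauto|now destruct (D _ Hz)].
    + destruct Hw as [Hw|[_ ->]%opair_inj]; [now destruct (D _ Hw)|easy].
Qed.

Lemma is_natural_emp : is_natural emp.
Proof.
  split; [apply Ord_emp|]; intros m [H| ->]; [now apply not_in_emp in H|].
  left; now apply is_empty_eq.
Qed.

Lemma is_natural_succ x : is_natural x -> is_natural (succ x).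
Proof.
  intros [H1 H2]; split; [now apply Ord_succ|]; intros m [H%in_succ| ->]; auto.
  right; exists x; now apply is_succ_eq.
Qed.

Lemma is_natural_num k : is_natural (num k).
Proof.
  induction k; [rewrite num_0; apply is_natural_emp|].
  rewrite num_S; now apply is_natural_succ.
Qed.

Lemma is_finite_emp : is_finite emp.
Proof.
  exists emp, emp; split; [apply is_natural_emp|split; [|split]].
  - apply is_fun_eq; repeat split; intros *; intros H; now apply not_in_emp in H.
  - intros x x' y H _; apply related_eq, not_in_emp in H as [].
  - intros y; split; [intros H; now apply not_in_emp in H|].
    intros (x & H); now apply related_eq, not_in_emp in H.
Qed.

Lemma is_finite_adjoin d i : is_finite d -> is_finite (adjoin d i).
Proof.
  intros Hd; destruct (classic (i ∈ d)) as [Hi|Hi]; [now rewrite adjoin_same|].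
  destruct Hd as (n & f & Hn & Hf & Hinj & Hr).
  setoid_rewrite related_eq in Hinj; setoid_rewrite related_eq in Hr.
  unfold elems in *.
  assert (Nn : ~ n ∈ n) by apply mem_irrefl.
  assert (D := is_fun_dom f n).
  exists (succ n), (adjoin f (opair n i)); split; [now apply is_natural_succ|].
  split; [now apply is_fun_adjoin|].
  setoid_rewrite related_eq; unfold elems; setoid_rewrite in_adjoin; split.
  - intros x x' y [H|[-> ->]%opair_inj] [H'|[-> E]%opair_inj]; auto.
    + eauto.
    + subst y; destruct Hi; apply Hr; eauto.
    + destruct Hi; apply Hr; eauto.
  - intros y; rewrite Hr; split.
    + intros [(x & Hx)| ->]; [eauto|exists n; auto].
    + intros (x & [Hx|[_ ->]%opair_inj]); eauto.
Qed.

Lemma is_varset_emp : is_varset emp.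
Proof.
  split; [apply is_finite_emp|]; intros i H; now apply not_in_emp in H.
Qed.

Lemma is_varset_adjoin d i : is_natural i -> is_varset d -> is_varset (adjoin d i).
Proof.
  intros Hi [H1 H2]; split; [now apply is_finite_adjoin|].
  intros j [H| ->]%in_adjoin; auto.
Qed.

Lemma update_exists a i b : exists a', is_update a' a i b.
Proof.
  destruct (separation (fun q => exists j y, j <> i /\ q = opair j y) a) as (s & Hs).
  { solve_class. }
  exists (adjoin s (opair i b)); intros q.
  setoid_rewrite is_opair_eq; rewrite in_adjoin, Hs; tauto.
Qed.

Lemma update_in a' a i b j y : is_update a' a i b ->
  opair j y ∈ a' <-> (j = i /\ y = b) \/ (j <> i /\ opair j y ∈ a).
Proof.
  intros H; rewrite (H (opair j y)); setoid_rewrite is_opair_eq; split.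
  - intros [[-> ->]%opair_inj|(K & j' & y' & N & [-> ->]%opair_inj)]; auto.
  - intros [[-> ->]|[N K]]; [auto|right; split; [easy|eauto]].
Qed.

Lemma update_is_fun a' a i b d : is_update a' a i b -> is_fun a d ->
  is_fun a' (adjoin d i).
Proof.
  intros U Ha; assert (K := fun j y => update_in a' a i b j y U).
  rewrite is_fun_eq in *; destruct Ha as (H1 & H2 & H3); split; [|split].
  - intros p Hp; apply U in Hp as Hp'; rewrite is_opair_eq in Hp'.
    destruct Hp' as [->|[Hp' _]].
    + exists i, b; rewrite in_adjoin; auto.
    + destruct (H1 p Hp') as (x & y & Hx & ->); exists x, y; rewrite in_adjoin; auto.
  - intros x Hx%in_adjoin; destruct (classic (x = i)) as [->|N].
    + exists b; apply K; auto.
    + destruct Hx as [Hx|Hx]; [|easy]; destruct (H2 x Hx) as (y & Hy).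
      exists y; apply K; auto.
  - intros x y z Hy%K Hz%K.
    destruct Hy as [[-> ->]|[N Hy]], Hz as [[Ez ->]|[N' Hz]]; try easy; eauto.
Qed.

(** One formation step over the pairs in [P]. With membership in a set for [P] it describes
    certificates, and with [L_formula_in] it describes the formulas themselves. *)
Definition formed (P : M -> M -> Prop) q e : Prop :=
  (exists i j, i ∈ e /\ j ∈ e /\ (q = fEq i j \/ q = fMem i j)) \/
  (exists i, i ∈ e /\ q = fIn i) \/
  (exists r, q = fNeg r /\ P r e) \/
  (exists R, q = fConj R /\ forall r, r ∈ R -> P r e) \/
  (exists i r, is_natural i /\ q = fAll i r /\ P r (adjoin e i)).

Ltac formed_inv :=
  intros [(?i & ?j & ?Hi & ?Hj & [E|E])|[(?i & ?Hi & E)|[(?r & E & ?Hr)|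
    [(?R & E & ?Hr)|(?i & ?r & ?Hi & E & ?Hr)]]]]; tag_cases E.

Lemma formed_eq P i j e : formed P (fEq i j) e <-> i ∈ e /\ j ∈ e.
Proof.
  split.
  - now formed_inv; apply opair_inj in E as [-> ->].
  - intros [H K]; left; exists i, j; auto.
Qed.

Lemma formed_mem P i j e : formed P (fMem i j) e <-> i ∈ e /\ j ∈ e.
Proof.
  split.
  - now formed_inv; apply opair_inj in E as [-> ->].
  - intros [H K]; left; exists i, j; auto.
Qed.

Lemma formed_in P i e : formed P (fIn i) e <-> i ∈ e.
Proof.
  split; [now formed_inv; subst|intros H; right; left; eauto].
Qed.

Lemma formed_neg P r e : formed P (fNeg r) e <-> P r e.
Proof.
  split; [now formed_inv; subst|intros H; do 2 right; left; eauto].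
Qed.

Lemma formed_conj P R e : formed P (fConj R) e <-> forall r, r ∈ R -> P r e.
Proof.
  split; [now formed_inv; subst|intros H; do 3 right; left; eauto].
Qed.

Lemma formed_all P i r e :
  formed P (fAll i r) e <-> is_natural i /\ P r (adjoin e i).
Proof.
  split; [|intros [H K]; do 4 right; eauto].
  now formed_inv; apply opair_inj in E as [-> ->].
Qed.

Lemma formed_shape P q e : formed P q e ->
  (exists i j, q = fEq i j) \/ (exists i j, q = fMem i j) \/ (exists i, q = fIn i) \/
  (exists r, q = fNeg r) \/ (exists R, q = fConj R) \/ (exists i r, q = fAll i r).
Proof.
  intros [(i & j & _ & _ & [E|E])|[(i & _ & E)|[(r & E & _)|[(R & E & _)|
    (i & r & _ & E & _)]]]]; subst q.
  - left; eauto.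
  - right; left; eauto.
  - do 2 right; left; eauto.
  - do 3 right; left; eauto.
  - do 4 right; left; eauto.
  - do 5 right; eauto.
Qed.

(** A code determines its formation rule, so the same rule is used for every index. The index [k]
    says that the family is not empty; otherwise nothing would give [q] a shape. *)
Lemma formed_inter (I : Type) (P : I -> M -> M -> Prop) (k : I) q e :
  (forall k, formed (P k) q e) -> formed (fun r e => forall k, P k r e) q e.
Proof.
  intros H; assert (K := H k).
  destruct (formed_shape _ _ _ K) as [(i & j & ->)|[(i & j & ->)|[(i & ->)|[(r & ->)|
    [(R & ->)|(i & r & ->)]]]]].
  - rewrite formed_eq in *; exact K.
  - rewrite formed_mem in *; exact K.
  - rewrite formed_in in *; exact K.
  - apply formed_neg; intros l; exact (proj1 (formed_neg _ _ _) (H l)).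
  - apply formed_conj; intros r Hr l; exact (proj1 (formed_conj _ _ _) (H l) r Hr).
  - apply formed_all; split; [apply (proj1 (formed_all _ _ _ _) K)|].
    intros l; exact (proj2 (proj1 (formed_all _ _ _ _) (H l))).
Qed.

Lemma formed_mono (P Q : M -> M -> Prop) q e :
  (forall r e, P r e -> Q r e) -> formed P q e -> formed Q q e.
Proof.
  intros H [K|[K|[(r & E & K)|[(R & E & K)|(i & r & Hi & E & K)]]]].
  - left; exact K.
  - right; left; exact K.
  - do 2 right; left; eauto.
  - do 3 right; left; eauto.
  - do 4 right; exists i, r; auto.
Qed.

Definition cert s : Prop :=
  forall q e, opair q e ∈ s -> formed (fun r e => opair r e ∈ s) q e.

Lemma L_formula_in_cert p d :
  L_formula_in p d <-> is_varset d /\ exists s, opair p d ∈ s /\ cert s.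
Proof.
  destruct code_funs as (E1 & E2 & E3 & E4 & E5 & E6 & E7 & _ & E9).
  unfold L_formula_in; rewrite E1, E2, E3, E4, E5, E6, E7, E9.
  unfold cert, formed, elems.
  split; intros [Hd (s & Hs & H)]; (split; [exact Hd|]); exists s;
    (split; [exact Hs|]); intros q e K; specialize (H q e K).
  - repeat (destruct H as [H|H]; [tauto|]); do 4 right.
    destruct H as (i & r & e' & Hi & Hq & -> & Hr); eauto.
  - repeat (destruct H as [H|H]; [tauto|]); do 4 right.
    destruct H as (i & r & Hi & Hq & Hr); exists i, r, (adjoin e i); auto.
Qed.
End Formulas.

Section FormulasFO.
Context {M : gb_structure} {HM : GBC M} {Good : (M -> Prop) -> Prop}.

Lemma fo_fEq : fo_term Good (n := 2) (fun X v => fEq (hd v) (hd (tl v))).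
Proof. unfold fEq; fo_tac. Qed.
Lemma fo_fMem : fo_term Good (n := 2) (fun X v => fMem (hd v) (hd (tl v))).
Proof. unfold fMem; fo_tac. Qed.
Lemma fo_fIn : fo_term Good (n := 1) (fun X v => fIn (hd v)).
Proof. unfold fIn; fo_tac. Qed.
Lemma fo_fNeg : fo_term Good (n := 1) (fun X v => fNeg (hd v)).
Proof. unfold fNeg; fo_tac. Qed.
Lemma fo_fConj : fo_term Good (n := 1) (fun X v => fConj (hd v)).
Proof. unfold fConj; fo_tac. Qed.
Lemma fo_fAll : fo_term Good (n := 2) (fun X v => fAll (hd v) (hd (tl v))).
Proof. unfold fAll; fo_tac. Qed.
End FormulasFO.
#[export] Hint Resolve fo_fEq fo_fMem fo_fIn fo_fNeg fo_fConj fo_fAll : fo.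

Section FormulasFO.
Context {M : gb_structure} {HM : GBC M} {Good : (M -> Prop) -> Prop}.


Lemma fo_is_natural : fo Good (n := 1) (fun X v => is_natural (hd v)).
Proof. unfold is_natural; fo_tac. Qed.
Lemma fo_is_fun : fo Good (n := 2) (fun X v => is_fun (hd v) (hd (tl v))).
Proof. unfold is_fun; fo_tac. Qed.
End FormulasFO.
#[export] Hint Resolve fo_is_natural fo_is_fun : fo.

Section FormulasFO.
Context {M : gb_structure} {HM : GBC M} {Good : (M -> Prop) -> Prop}.

Lemma fo_is_varset : fo Good (n := 1) (fun X v => is_varset (hd v)).
Proof. unfold is_varset, is_finite; fo_tac. Qed.
End FormulasFO.
#[export] Hint Resolve fo_is_varset : fo.

Section FormulasFO.
Context {M : gb_structure} {HM : GBC M} {Good : (M -> Prop) -> Prop}.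

Lemma fo_cert : fo Good (n := 1) (fun X v => cert (hd v)).
Proof. unfold cert, formed; fo_tac. Qed.
End FormulasFO.
#[export] Hint Resolve fo_cert : fo.

Section FormulasFO.
Context {M : gb_structure} {HM : GBC M} {Good : (M -> Prop) -> Prop}.

Lemma fo_L_formula_in : fo Good (n := 2) (fun X v => L_formula_in (hd v) (hd (tl v))).
Proof.
  apply fo_iff with (fun X v => is_varset (hd (tl v)) /\
    exists s, opair (hd v) (hd (tl v)) ∈ s /\ cert s).
  - intros X v; symmetry; apply L_formula_in_cert.
  - fo_tac.
Qed.
End FormulasFO.
#[export] Hint Resolve fo_L_formula_in : fo.

Section FormulasFO.
Context {M : gb_structure} {HM : GBC M} {Good : (M -> Prop) -> Prop}.

Lemma fo_L_formula : fo Good (n := 1) (fun X v => L_formula (hd v)).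
Proof. unfold L_formula; fo_tac. Qed.
Lemma fo_imm : fo Good (n := 2) (fun X v => imm (hd v) (hd (tl v))).
Proof. unfold imm; fo_tac. Qed.
Lemma fo_is_valuation : fo Good (n := 2) (fun X v => is_valuation (hd v) (hd (tl v))).
Proof. unfold is_valuation; fo_tac. Qed.
End FormulasFO.
#[export] Hint Resolve fo_imm fo_L_formula : fo.

Section FormulasFO.
Context {M : gb_structure} {HM : GBC M} {Good : (M -> Prop) -> Prop}.

Lemma fo_subformula : fo Good (n := 2) (fun X v => subformula (hd v) (hd (tl v))).
Proof.
  apply fo_iff with (fun X v => forall s, hd (tl v) ∈ s ->
    (forall r r', r ∈ s -> imm r' r -> r' ∈ s) -> hd v ∈ s).
  - intros X v; unfold subformula; setoid_rewrite imm_eq; reflexivity.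
  - fo_tac.
Qed.
End FormulasFO.
#[export] Hint Resolve fo_is_valuation fo_subformula : fo.

Section FormulaTheory.
Context {M : gb_structure} {HM : GBC M}.
Implicit Types x y z a b d e p q r i j s J : M.

(** Needed above all for conjunctions: the conjuncts have separate certificates, and a single set
    must certify all of them. *)
Lemma cert_collect J :
  (forall z, z ∈ J -> exists r e, z = opair r e /\ L_formula_in r e) ->
  exists s, (forall z, z ∈ J -> z ∈ s) /\ cert s.
Proof.
  intros HJ.
  (* Certificates of a pair are closed under intersection, so the least one
     can be picked out and replacement applies. *)
  destruct (replacement (fun z m => (exists s, cert s /\ z ∈ s) /\
    forall y, y ∈ m <-> forall s, cert s -> z ∈ s -> y ∈ s) J) as (B & HB).
  { fo_tac. }
  { intros z m m' (_ & H) (_ & H'); apply set_ext; intros y; now rewrite H, H'. }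
  exists (bigcup B); split.
  - intros z Hz; destruct (HJ z Hz) as (r & e & -> & (_ & s & Hs & Cs)%L_formula_in_cert).
    destruct (separation (fun y => forall s, cert s -> opair r e ∈ s -> y ∈ s) s)
      as (m & Hm); [solve_class|].
    apply in_bigcup; exists m; split.
    + apply HB; exists (opair r e); split; [exact Hz|split; [eauto|]].
      intros y; rewrite Hm; split; [tauto|eauto].
    + apply Hm; auto.
  - intros q e (m & Hm & Hq)%in_bigcup.
    destruct (proj1 (HB m) Hm) as (z & Hz & (s0 & Cs0 & Hzs0) & Em).
    apply formed_mono with (fun r e =>
      forall k : {s | cert s /\ z ∈ s}, opair r e ∈ proj1_sig k).
    + intros r e' H; apply in_bigcup; exists m; split; [exact Hm|]; apply Em.
      intros s Cs Hs; exact (H (exist _ s (conj Cs Hs))).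
    + apply (formed_inter _ (fun k r e => opair r e ∈ proj1_sig k)).
      * exact (exist _ s0 (conj Cs0 Hzs0)).
      * intros (s & Cs & Hs); simpl; apply Cs; now apply Em.
Qed.

(** From right to left, a common certificate for the set [J] of immediate constituents is enlarged
    by the pair <p,d> itself. *)
Lemma L_formula_in_iff p d :
  L_formula_in p d <-> is_varset d /\ formed L_formula_in p d.
Proof.
  split.
  - intros [Hd (s & Hs & Cs)]%L_formula_in_cert; split; [exact Hd|].
    assert (V : forall r, opair r d ∈ s -> L_formula_in r d).
    { intros r Hr; apply L_formula_in_cert; eauto. }
    destruct (Cs _ _ Hs) as [H|[H|[(r & E & H)|[(R & E & H)|(i & r & Hi & E & H)]]]].
    + left; exact H.
    + right; left; exact H.
    + do 2 right; left; eauto.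
    + do 3 right; left; eauto.
    + do 4 right; exists i, r; split; [easy|split; [easy|]].
      apply L_formula_in_cert; split; [now apply is_varset_adjoin|eauto].
  - intros [Hd F]; apply L_formula_in_cert; split; [exact Hd|].
    assert (G : exists J, (forall z, z ∈ J -> exists r e, z = opair r e /\ L_formula_in r e)
      /\ formed (fun r e => opair r e ∈ J) p d).
    { destruct F as [H|[H|[(r & -> & H)|[(R & -> & H)|(i & r & Hi & -> & H)]]]].
      - exists emp; split; [intros z Hz; now apply not_in_emp in Hz|now left].
      - exists emp; split; [intros z Hz; now apply not_in_emp in Hz|right; now left].
      - exists (sing (opair r d)); split; [intros z ->%in_sing; eauto|].
        apply formed_neg, in_sing; easy.
      - destruct (replacement (fun r z => z = opair r d) R) as (J & HJ);
          [fo_tac|congruence|].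
        exists J; split; [intros z (r & Hr & ->)%HJ; eauto|].
        apply formed_conj; intros r Hr; apply HJ; eauto.
      - exists (sing (opair r (adjoin d i))); split; [intros z ->%in_sing; eauto|].
        apply formed_all; split; [exact Hi|now apply in_sing]. }
    destruct G as (J & HJ & HF), (cert_collect J HJ) as (s & Hs & Cs).
    exists (adjoin s (opair p d)); split; [apply in_adjoin; auto|].
    intros q e [H|[-> ->]%opair_inj]%in_adjoin.
    + apply formed_mono with (2 := Cs q e H); intros; apply in_adjoin; auto.
    + apply formed_mono with (2 := HF); intros; apply in_adjoin; auto.
Qed.

Lemma L_formula_in_eq i j d : is_varset d -> i ∈ d -> j ∈ d -> L_formula_in (fEq i j) d.
Proof. intros H Hi Hj; apply L_formula_in_iff; split; [easy|now apply formed_eq]. Qed.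

Lemma L_formula_in_mem i j d : is_varset d -> i ∈ d -> j ∈ d -> L_formula_in (fMem i j) d.
Proof. intros H Hi Hj; apply L_formula_in_iff; split; [easy|now apply formed_mem]. Qed.

Lemma L_formula_in_in i d : is_varset d -> i ∈ d -> L_formula_in (fIn i) d.
Proof. intros H Hi; apply L_formula_in_iff; split; [easy|now apply formed_in]. Qed.

Lemma L_formula_in_varset p d : L_formula_in p d -> is_varset d.
Proof. intros [H _]; exact H. Qed.

Lemma L_formula_in_neg p d : L_formula_in (fNeg p) d <-> L_formula_in p d.
Proof.
  rewrite L_formula_in_iff, formed_neg; split; [tauto|].
  intros H; split; [now apply L_formula_in_varset in H|exact H].
Qed.

Lemma L_formula_in_conj Q d :
  L_formula_in (fConj Q) d <-> is_varset d /\ forall q, q ∈ Q -> L_formula_in q d.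
Proof. now rewrite L_formula_in_iff, formed_conj. Qed.

Lemma L_formula_in_all i p d : L_formula_in (fAll i p) d <->
  is_varset d /\ is_natural i /\ L_formula_in p (adjoin d i).
Proof. now rewrite L_formula_in_iff, formed_all. Qed.

Lemma imm_neg q p : imm q (fNeg p) <-> q = p.
Proof.
  split; [|intros ->; now left].
  intros [E|[(Q & E & _)|(i & E)]]; tag_cases E; easy.
Qed.

Lemma imm_conj q Q : imm q (fConj Q) <-> q ∈ Q.
Proof.
  split; [|intros H; right; left; eauto].
  intros [E|[(R & E & H)|(i & E)]]; tag_cases E; now subst.
Qed.

Lemma imm_all q i p : imm q (fAll i p) <-> q = p.
Proof.
  split; [|intros ->; right; right; eauto].
  intros [E|[(R & E & H)|(j & E)]]; tag_cases E; now apply opair_inj in E as [_ ->].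
Qed.

Lemma imm_eq_code q i j : ~ imm q (fEq i j).
Proof. intros [E|[(R & E & H)|(k & E)]]; tag_cases E. Qed.

Lemma imm_mem_code q i j : ~ imm q (fMem i j).
Proof. intros [E|[(R & E & H)|(k & E)]]; tag_cases E. Qed.

Lemma imm_in_code q i : ~ imm q (fIn i).
Proof. intros [E|[(R & E & H)|(k & E)]]; tag_cases E. Qed.

Lemma L_formula_imm p q : L_formula p -> imm q p -> L_formula q.
Proof.
  intros [d H] [->|[(Q & -> & K)|(i & ->)]].
  - rewrite L_formula_in_neg in H; now exists d.
  - apply L_formula_in_conj in H; exists d; now apply H.
  - apply L_formula_in_all in H; now exists (adjoin d i).
Qed.

Lemma L_formula_not_emp p : L_formula p -> p <> emp.
Proof.
  intros [d [_ H]%L_formula_in_iff] E.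
  destruct (formed_shape _ _ _ H) as [(i & j & ->)|[(i & j & ->)|[(i & ->)|[(r & ->)|
    [(R & ->)|(i & r & ->)]]]]]; exact (opair_not_emp _ _ E).
Qed.

(** Holds for arbitrary sets, formulas or not. The deepest case is the quantifier, where [q] lies in
    {i,q}, which lies in <i,q>, which lies in {5,<i,q>}, an element of the code. *)
Lemma formula_induction (P : M -> Prop) :
  is_class P -> (forall p, (forall q, imm q p -> P q) -> P p) -> forall p, P p.
Proof.
  intros HP H; apply deep_induction; [exact HP|]; intros p IH; apply H.
  assert (U : forall x y, upair x y ∈ opair x y) by (intros; apply in_upair; auto).
  assert (V : forall x y, y ∈ upair x y) by (intros; apply in_upair; auto).
  intros q [->|[(Q & -> & K)|(i & ->)]].
  - eapply IH; [apply U|]; auto.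
  - eapply IH; [apply U|]; do 2 right; eauto.
  - eapply IH; [apply U|]; do 2 right; exists (opair i q); split; [apply V|right; eauto].
Qed.

(** * Truth *)

(* At most one conjunct is not vacuous: the clause of the truth definition that
   applies to [p], with [tr] giving the truth of its immediate subformulas. *)
Definition tarski (A : M -> Prop) (tr : M -> M -> Prop) p a : Prop :=
  (forall i j, p = fEq i j -> exists x, opair i x ∈ a /\ opair j x ∈ a) /\
  (forall i j, p = fMem i j -> exists x y, opair i x ∈ a /\ opair j y ∈ a /\ x ∈ y) /\
  (forall i, p = fIn i -> exists x, opair i x ∈ a /\ A x) /\
  (forall q, p = fNeg q -> ~ tr q a) /\
  (forall Q, p = fConj Q -> forall q, q ∈ Q -> tr q a) /\
  (forall i q, p = fAll i q -> forall b a', is_update a' a i b -> tr q a').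

Ltac tarski_inv := unfold tarski; intros; split;
  [ try (intros (H1 & H2 & H3 & H4 & H5 & H6))
  | intros ?Hx; repeat split; try (intros *; intros ?E; tag_cases E) ].

Lemma tarski_eq A tr i j a :
  tarski A tr (fEq i j) a <-> exists x, opair i x ∈ a /\ opair j x ∈ a.
Proof. tarski_inv; [now apply H1|now apply opair_inj in E as [-> ->]]. Qed.

Lemma tarski_mem A tr i j a :
  tarski A tr (fMem i j) a <-> exists x y, opair i x ∈ a /\ opair j y ∈ a /\ x ∈ y.
Proof. tarski_inv; [now apply H2|now apply opair_inj in E as [-> ->]]. Qed.

Lemma tarski_in (A : M -> Prop) tr i a :
  tarski A tr (fIn i) a <-> exists x, opair i x ∈ a /\ A x.
Proof. tarski_inv; [now apply H3|now subst]. Qed.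

Lemma tarski_neg A (tr : M -> M -> Prop) q a : tarski A tr (fNeg q) a <-> ~ tr q a.
Proof. tarski_inv; [now apply H4|now subst]. Qed.

Lemma tarski_conj A (tr : M -> M -> Prop) Q a :
  tarski A tr (fConj Q) a <-> forall q, q ∈ Q -> tr q a.
Proof. tarski_inv; [now apply H5|now subst]. Qed.

Lemma tarski_all A (tr : M -> M -> Prop) i q a :
  tarski A tr (fAll i q) a <-> forall b a', is_update a' a i b -> tr q a'.
Proof.
  tarski_inv; [now apply (H6 i q)|].
  apply opair_inj in E as [-> ->]; apply Hx.
Qed.

Lemma tarski_ext A (tr tr' : M -> M -> Prop) p a :
  (forall q a, imm q p -> (tr q a <-> tr' q a)) ->
  (tarski A tr p a <-> tarski A tr' p a).
Proof.
  intros H.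
  assert (H1 : forall q, p = fNeg q -> forall a, tr q a <-> tr' q a).
  { intros q -> a'; apply H; now left. }
  assert (H2 : forall Q q, p = fConj Q -> q ∈ Q -> forall a, tr q a <-> tr' q a).
  { intros Q q -> Hq a'; apply H; right; left; eauto. }
  assert (H3 : forall i q, p = fAll i q -> forall a, tr q a <-> tr' q a).
  { intros i q -> a'; apply H; right; right; eauto. }
  unfold tarski; split; intros (K1 & K2 & K3 & K4 & K5 & K6); repeat split; auto.
  - intros q E; rewrite <- H1; auto.
  - intros Q E q Hq; rewrite <- (H2 Q); auto; eapply K5; eauto.
  - intros i q E b a' U; rewrite <- (H3 i); auto; eapply K6; eauto.
  - intros q E; rewrite H1; auto.
  - intros Q E q Hq; rewrite (H2 Q); auto; eapply K5; eauto.
  - intros i q E b a' U; rewrite (H3 i); auto; eapply K6; eauto.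
Qed.

(** The existence of a valuation already says that [p] is a formula, so exactly one clause applies
    to it and the six equivalences merge into one. *)
Lemma truth_predicate_iff (A D T : M -> Prop) :
  truth_predicate A D T <->
  is_class T /\
  (forall t, T t -> exists p a, D p /\ is_valuation a p /\ t = opair p a) /\
  (forall p a, D p -> is_valuation a p ->
    (T (opair p a) <-> tarski A (fun q a => T (opair q a)) p a)).
Proof.
  destruct (code_funs (M := M)) as (E1 & E2 & E3 & E4 & E5 & E6 & E7 & E8 & _).
  unfold truth_predicate; rewrite E1, E2, E3, E4, E5, E6, E7, E8; unfold elems.
  split; intros (H1 & H2 & H3); (split; [exact H1|split; [exact H2|]]);
    intros p a Hp Ha; specialize (H3 p a Hp Ha).
  - destruct H3 as (K1 & K2 & K3 & K4 & K5 & K6).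
    assert (Hs : L_formula p) by (destruct Ha as (d & _ & Hd); now exists d).
    destruct Hs as (d & [_ Hs]%L_formula_in_iff).
    destruct (formed_shape _ _ _ Hs) as [(i & j & ->)|[(i & j & ->)|[(i & ->)|[(r & ->)|
      [(R & ->)|(i & r & ->)]]]]].
    + rewrite (K1 i j eq_refl), tarski_eq; split.
      * intros (x & y & Hx & Hy & ->); eauto.
      * intros (x & Hx & Hy); eauto.
    + now rewrite (K2 i j eq_refl), tarski_mem.
    + now rewrite (K3 i eq_refl), tarski_in.
    + now rewrite (K4 r eq_refl), tarski_neg.
    + now rewrite (K5 R eq_refl), tarski_conj.
    + now rewrite (K6 i r eq_refl), tarski_all.
  - refine (conj _ (conj _ (conj _ (conj _ (conj _ _))))).
    + intros i j ->; rewrite H3, tarski_eq; split.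
      * intros (x & Hx & Hy); eauto.
      * intros (x & y & Hx & Hy & ->); eauto.
    + now intros i j ->; rewrite H3, tarski_mem.
    + now intros i ->; rewrite H3, tarski_in.
    + now intros q ->; rewrite H3, tarski_neg.
    + now intros Q ->; rewrite H3, tarski_conj.
    + now intros i q ->; rewrite H3, tarski_all.
Qed.
End FormulaTheory.

(** * Uniqueness and restriction of truth predicates *)

Section TruthPredicates.
Context {M : gb_structure} {HM : GBC M}.
Implicit Types x y z a b d e p q r i j s : M.
Implicit Types A D T : M -> Prop.

Lemma valuation_neg a q : is_valuation a (fNeg q) -> is_valuation a q.
Proof. intros (d & Ha & H); exists d; now rewrite L_formula_in_neg in H. Qed.

Lemma valuation_conj a q Q : is_valuation a (fConj Q) -> q ∈ Q -> is_valuation a q.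
Proof.
  intros (d & Ha & H) Hq; exists d; rewrite L_formula_in_conj in H.
  split; [exact Ha|now apply H].
Qed.

Lemma valuation_all a a' i b q :
  is_valuation a (fAll i q) -> is_update a' a i b -> is_valuation a' q.
Proof.
  intros (d & Ha & H) U; exists (adjoin d i); rewrite L_formula_in_all in H.
  split; [now apply (update_is_fun a' a i b d)|apply H].
Qed.

Definition imm_closed D : Prop := forall p q, D p -> imm q p -> D q.

Lemma truth_valuation A D T p a :
  truth_predicate A D T -> T (opair p a) -> D p /\ is_valuation a p.
Proof.
  intros (_ & H & _)%truth_predicate_iff K.
  now destruct (H _ K) as (p' & a' & Hp & Ha & [-> ->]%opair_inj).
Qed.

Lemma truth_tarski A D T p a : truth_predicate A D T -> D p -> is_valuation a p ->
  (T (opair p a) <-> tarski A (fun q a => T (opair q a)) p a).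
Proof. intros (_ & _ & H)%truth_predicate_iff; apply H. Qed.

(** Induction on [p]: the truth clause looks only at immediate subformulas, which stay in both
    domains. If [a] is not a valuation of [p], both sides are false. *)
Lemma truth_unique A D D' T T' p a :
  is_class D -> is_class D' -> imm_closed D -> imm_closed D' ->
  truth_predicate A D T -> truth_predicate A D' T' ->
  D p -> D' p -> T (opair p a) <-> T' (opair p a).
Proof.
  intros HD HD' CD CD' HT HT' Dp Dp'; revert a; revert p Dp Dp'.
  assert (KT : is_class T) by apply HT.
  assert (KT' : is_class T') by apply HT'.
  apply (formula_induction (fun p => D p -> D' p ->
    forall a, T (opair p a) <-> T' (opair p a))); [solve_class|].
  intros p IH Dp Dp' a.
  assert (V : is_valuation a p -> T (opair p a) <-> T' (opair p a)).
  { intros Ha; rewrite (truth_tarski A D T), (truth_tarski A D' T'); auto.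
    apply tarski_ext; intros q a' Hq; apply IH; eauto. }
  split; intros H; apply V; auto;
    eapply truth_valuation in H; eauto; apply H.
Qed.

Lemma subformula_refl p : subformula p p.
Proof. intros s H _; exact H. Qed.

Lemma subformula_imm_closed p : imm_closed (fun q => subformula q p).
Proof.
  intros q r H Hr s Hs C; apply C with q; [|now apply imm_eq]; now apply H.
Qed.

(** Subformulas are defined through closed sets, whereas [D] may be a proper class. The formulas in
    [D] that occur in a certificate of [p] form a set that contains [p] and is closed under
    immediate subformulas. *)
Lemma subformula_in D p q : is_class D -> imm_closed D -> L_formula p -> D p ->
  subformula q p -> D q /\ L_formula q.
Proof.
  intros HD CD (d & [Hd (s & Hs & Cs)]%L_formula_in_cert) Dp H.
  assert (is_class (fun q => D q /\ L_formula q)) as HDL by solve_class.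
  destruct (replacement (fun z q => (exists e, z = opair q e) /\ D q /\ L_formula q) s)
    as (t & Ht).
  { fo_tac. }
  { intros z q1 q2 ((e & ->) & _) ((e' & [-> _]%opair_inj) & _); reflexivity. }
  assert (K : q ∈ t).
  { apply H.
    - apply Ht; exists (opair p d); split; [easy|split; [eauto|split; [easy|]]].
      exists d; apply L_formula_in_cert; eauto.
    - intros r r' (z & Hz & (e & ->) & Dr & Lr)%Ht Hr'%imm_eq; apply Ht.
      assert (G : exists e', opair r' e' ∈ s).
      { specialize (Cs _ _ Hz); destruct Hr' as [->|[(Q & -> & K)|(i & ->)]].
        - rewrite formed_neg in Cs; eauto.
        - rewrite formed_conj in Cs; eauto.
        - rewrite formed_all in Cs; destruct Cs; eauto. }
      destruct G as (e' & He'); exists (opair r' e'); split; [easy|split; [eauto|split]].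
      + eapply CD; eauto.
      + eapply L_formula_imm; eauto. }
  now apply Ht in K as (z & _ & _ & K).

Qed.

Lemma truth_restrict A D T p : is_class D -> imm_closed D -> truth_predicate A D T ->
  L_formula p -> D p ->
  truth_predicate_for A p (fun t => T t /\ exists q a, t = opair q a /\ subformula q p).
Proof.
  intros HD CD HT Lp Dp; assert (KT : is_class T) by apply HT.
  apply truth_predicate_iff; split; [solve_class|split].
  - intros t [Ht (q & a & -> & Hq)]; exists q, a; split; [exact Hq|split; [|easy]].
    eapply truth_valuation; eauto.
  - intros q a Hq Ha.
    assert (E : forall r a, subformula r p ->
      (T (opair r a) /\ (exists q a', opair r a = opair q a' /\ subformula q p)) <->
      T (opair r a)).
    { intros r a' Hr; split; [tauto|]; intros H; eauto. }
    rewrite E by exact Hq.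
    rewrite (truth_tarski A D T) by
      (auto; now apply (subformula_in D p q)).
    apply tarski_ext; intros r a' Hr; symmetry; apply E.
    now apply (subformula_imm_closed p q).
Qed.

(** [true_at] quantifies over classes. One truth predicate that covers all relevant formulas
    replaces it by a first-order condition. *)
Lemma true_at_iff A D T p a : is_class D -> imm_closed D -> truth_predicate A D T ->
  L_formula p -> D p -> (true_at A p a <-> T (opair p a)).
Proof.
  intros HD CD HT Lp Dp; unfold true_at; split.
  - intros (T' & HT' & K); apply related_eq in K.
    apply (truth_unique A D (fun q => subformula q p) T T' p a); auto.
    + solve_class.
    + apply subformula_imm_closed.
    + apply subformula_refl.
  - intros H; eexists; split; [now apply (truth_restrict A D T p)|].
    apply related_eq; split; [exact H|exists p, a; split; [easy|apply subformula_refl]].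
Qed.

Lemma L_formula_imm_closed : imm_closed L_formula.
Proof. intros p q; apply L_formula_imm. Qed.

Lemma is_class_L_formula : is_class (@L_formula M).
Proof. solve_class. Qed.

Lemma truth_join_meet : Ord_omega_truth M ->
  class_join_separation M /\ class_meet_separation M.
Proof.
  intros H; split; intros A Phi d HA HPhi Hd HF HT; destruct (H A HA) as (T & HTr);
    assert (KT : is_class T) by apply HTr.
  - replace (fun a => is_fun a d /\ exists p, Phi p /\ true_at A p a) with
      (fun a => is_fun a d /\ exists p, Phi p /\ T (opair p a)); [solve_class|].
    apply class_ext; intros a.
    assert (E : forall p, Phi p -> true_at A p a <-> T (opair p a)).
    { intros p Hp; assert (Lp : L_formula p) by (exists d; auto).
      apply (true_at_iff A L_formula); auto using is_class_L_formula, L_formula_imm_closed. }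
    split; intros [Ha (p & Hp & K)]; split; auto; exists p; split; auto; now apply E.
  - replace (fun a => is_fun a d /\ forall p, Phi p -> true_at A p a) with
      (fun a => is_fun a d /\ forall p, Phi p -> T (opair p a)); [solve_class|].
    apply class_ext; intros a.
    assert (E : forall p, Phi p -> true_at A p a <-> T (opair p a)).
    { intros p Hp; assert (Lp : L_formula p) by (exists d; auto).
      apply (true_at_iff A L_formula); auto using is_class_L_formula, L_formula_imm_closed. }
    split; intros [Ha K]; split; auto; intros p Hp; apply E; auto.
Qed.
End TruthPredicates.

(** * The truth recursion *)

Section TruthRecursion.
Context {M : gb_structure} {HM : GBC M}.
Implicit Types x y z a b c d e p q r i j s : M.
Implicit Types A D L S T X : M -> Prop.

Definition earlier X z : Prop := exists b, X (opair b z).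

(* A stage contains <∅,p> if the immediate subformulas of [p] have been decided
   at earlier stages, and then also <p,a> for the valuations [a] making [p]
   true.  The marks <∅,p> make do without a rank function on formulas. *)
Definition truth_stage A X x : Prop :=
  exists p, L_formula p /\ (forall q, imm q p -> earlier X (opair emp q)) /\
    (x = opair emp p \/
     exists a, x = opair p a /\ is_valuation a p /\
       tarski A (fun q a => earlier X (opair q a)) p a).

Lemma truth_stage_formula A : exists rho : formula 2 1,
  forall X x, sat [X; A] rho [x] <-> truth_stage A X x.
Proof.
  destruct (fo_formula A (fun X v => truth_stage A X (hd v))) as (rho & H).
  - unfold truth_stage, earlier, tarski, is_update; fo_tac.
  - exists rho; intros X x; apply (H X [x]).
Qed.

Lemma restr_opair S b c x : restr S b (opair c x) <-> S (opair c x) /\ c ∈ b.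
Proof.
  unfold restr; setoid_rewrite is_opair_eq; split.
  - now intros (H & c' & x' & Hc & [-> ->]%opair_inj).
  - intros [H Hc]; split; [exact H|eauto].
Qed.

Lemma solution_iff phi A L S :
  solution phi A L S <->
  is_class S /\ (forall p, S p -> exists a x, L a /\ p = opair a x) /\
  (forall a x, L a -> (S (opair a x) <-> sat [restr S a; A] phi [x])).
Proof.
  unfold solution; setoid_rewrite is_opair_eq; setoid_rewrite related_eq; reflexivity.
Qed.

Context (A : M -> Prop) (rho : formula 2 1).
Hypothesis Hrho : forall X x, sat [X; A] rho [x] <-> truth_stage A X x.
Context (L S : M -> Prop).
Hypothesis HA : is_class A.
Hypothesis HL : is_class L.
Hypothesis L_trans : forall b c, L b -> c ∈ b -> L c.
Hypothesis HS : solution rho A L S.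
Hint Resolve HL : fo.

Let Sclass : is_class S.
Proof. apply HS. Qed.
Hint Resolve Sclass : fo.

Let before b z := exists c, c ∈ b /\ S (opair c z).

Let stage_iff b x : L b -> S (opair b x) <->
  exists p, L_formula p /\ (forall q, imm q p -> before b (opair emp q)) /\
    (x = opair emp p \/ exists a, x = opair p a /\ is_valuation a p /\
       tarski A (fun q a => before b (opair q a)) p a).
Proof.
  intros Hb; pose proof HS as (_ & _ & H)%solution_iff; rewrite (H b x Hb), Hrho.
  unfold truth_stage.
  replace (earlier (restr S b)) with (before b); [reflexivity|].
  apply class_ext; intros z; unfold earlier, before; setoid_rewrite restr_opair.
  split; intros (c & H1 & H2); eauto.
Qed.

(** A mark cannot be confused with a pair of a formula and a valuation, because ∅ is not a
    formula. *)
Lemma marked_iff b p : L b -> S (opair b (opair emp p)) <->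
  L_formula p /\ forall q, imm q p -> exists c, c ∈ b /\ S (opair c (opair emp q)).
Proof.
  intros Hb; rewrite (stage_iff b _ Hb); split.
  - intros (p' & Lp & H & [[_ ->]%opair_inj|(a & [E _]%opair_inj & _)]); auto.
    now destruct (L_formula_not_emp p' Lp).
  - intros [Lp H]; exists p; auto.
Qed.

Lemma true_stage_iff b p a : L b -> L_formula p -> S (opair b (opair p a)) <->
  S (opair b (opair emp p)) /\ is_valuation a p /\
  tarski A (fun q a => before b (opair q a)) p a.
Proof.
  intros Hb Lp; rewrite (marked_iff b p Hb), (stage_iff b _ Hb); split.
  - intros (p' & Lp' & H & [[E _]%opair_inj|(a' & [-> ->]%opair_inj & K)]).
    + now destruct (L_formula_not_emp p Lp).
    + auto.
  - intros ([_ H] & K); exists p; split; [easy|split; [exact H|right; eauto]].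
Qed.

Definition decided p : Prop := exists b, L b /\ S (opair b (opair emp p)).
(** The first conjunct discards the marks. *)
Definition decided_true t : Prop :=
  (exists p a, t = opair p a /\ L_formula p) /\ exists b, L b /\ S (opair b t).

Lemma is_class_decided : is_class decided.
Proof. unfold decided; solve_class. Qed.

Lemma is_class_decided_true : is_class decided_true.
Proof. unfold decided_true; solve_class. Qed.
Hint Resolve is_class_decided is_class_decided_true : fo.

Lemma decided_formula p : decided p -> L_formula p.
Proof. intros (b & Hb & H); now apply marked_iff in H. Qed.

Lemma decided_imm_closed : imm_closed decided.
Proof.
  intros p q (b & Hb & H) Hq; apply marked_iff in H as [_ H]; [|exact Hb].
  destruct (H q Hq) as (c & Hc & K); exists c; split; [now apply (L_trans b)|exact K].
Qed.

Lemma decided_true_iff p a : L_formula p ->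
  decided_true (opair p a) <-> exists b, L b /\ S (opair b (opair p a)).
Proof. intros Lp; unfold decided_true; split; [tauto|]; intros H; split; eauto. Qed.

(** Once [p] is marked at a stage, each immediate subformula is marked at some earlier stage, where
    by induction its truth is already final. So the truth clause gives the same answer at every
    stage where [p] is marked. *)
Lemma stage_independent p : forall b a, L b -> S (opair b (opair emp p)) ->
  (S (opair b (opair p a)) <-> decided_true (opair p a)) /\
  (S (opair b (opair p a)) <->
   is_valuation a p /\ tarski A (fun q a => decided_true (opair q a)) p a).
Proof.
  revert p; apply (formula_induction (fun p => forall b a, L b ->
    S (opair b (opair emp p)) ->
    (S (opair b (opair p a)) <-> decided_true (opair p a)) /\
    (S (opair b (opair p a)) <->
     is_valuation a p /\ tarski A (fun q a => decided_true (opair q a)) p a))).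
  { unfold tarski, is_update; solve_class. }
  intros p IH.
  assert (K : forall b a, L b -> S (opair b (opair emp p)) ->
    (S (opair b (opair p a)) <-> is_valuation a p /\
      (tarski A (fun q a => decided_true (opair q a)) p a))).
  { intros b a Hb Hp; assert (Lp : L_formula p) by (apply decided_formula; now exists b).
    rewrite (true_stage_iff b p a Hb Lp).
    rewrite (tarski_ext A (fun q a => before b (opair q a))
      (fun q a => decided_true (opair q a))); [tauto|].
    intros q a' Hq; assert (Lq := L_formula_imm _ _ Lp Hq).
    rewrite (decided_true_iff q a' Lq); split.
    - intros (c & Hc & H); exists c; split; [now apply (L_trans b)|exact H].
    - intros H; destruct (proj2 (proj1 (marked_iff b p Hb) Hp) q Hq) as (c & Hc & Mc).
      exists c; split; [exact Hc|].
      apply (proj1 (IH q Hq c a' (L_trans b c Hb Hc) Mc)).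
      now apply decided_true_iff. }
  intros b a Hb Hp; split; [|now apply K].
  assert (Lp : L_formula p) by (apply decided_formula; now exists b).
  rewrite (decided_true_iff p a Lp); split; [eauto|].
  intros (b' & Hb' & H); apply K; auto; apply (K b' a Hb'); auto.
  now apply true_stage_iff in H.
Qed.

Lemma decided_truth : truth_predicate A decided decided_true.
Proof.
  apply truth_predicate_iff; split; [apply is_class_decided_true|split].
  - intros t [(p & a & -> & Lp) (b & Hb & H)]; exists p, a.
    apply (true_stage_iff b p a Hb Lp) in H as (Mp & Va & _).
    split; [now exists b|auto].
  - intros p a (b & Hb & Mp) Va; destruct (stage_independent p b a Hb Mp) as [H1 H2].
    rewrite <- H1, H2; tauto.
Qed.

(** The immediate subformulas of [p] form a set, so the stages at which they are decided are bounded
    by an ordinal; length [Ord] guarantees that the bound is itself a stage. *)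
Lemma all_decided : L = Ord -> forall p, L_formula p -> decided p.
Proof.
  intros EL; apply (formula_induction (fun p => L_formula p -> decided p));
    [solve_class|].
  intros p IH Lp.
  assert (HI : exists I, forall q, imm q p <-> q ∈ I).
  { destruct Lp as (d & [_ H]%L_formula_in_iff).
    destruct (formed_shape _ _ _ H) as [(i & j & ->)|[(i & j & ->)|[(i & ->)|[(r & ->)|
      [(R & ->)|(i & r & ->)]]]]].
    - exists emp; intros q; split; intros K;
        [now apply imm_eq_code in K|now apply not_in_emp in K].
    - exists emp; intros q; split; intros K;
        [now apply imm_mem_code in K|now apply not_in_emp in K].
    - exists emp; intros q; split; intros K;
        [now apply imm_in_code in K|now apply not_in_emp in K].
    - exists (sing r); intros q; now rewrite imm_neg, in_sing.
    - exists R; intros q; apply imm_conj.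
    - exists (sing r); intros q; now rewrite imm_all, in_sing. }
  destruct HI as (I & HI).
  destruct (Ord_bound (fun q b => S (opair b (opair emp q))) I) as (b & Hb & K).
  { fo_tac. }
  { intros q Hq%HI; destruct (IH q Hq) as (b & Hb & H); [eapply L_formula_imm; eauto|].
    rewrite EL in Hb; now exists b. }
  exists b; rewrite EL; split; [exact Hb|].
  apply marked_iff; [now rewrite EL|]; split; [exact Lp|].
  intros q Hq; apply K; now apply HI.
Qed.
End TruthRecursion.

Section TruthFromRecursion.
Context {M : gb_structure} {HM : GBC M}.

Lemma solution_truth (A : M -> Prop) rho S : is_class A ->
  (forall X x, sat [X; A] rho [x] <-> truth_stage A X x) ->
  solution rho A Ord S -> exists T, truth_predicate A L_formula T.
Proof.
  intros HA Hrho HS; exists (decided_true Ord S).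
  replace (@L_formula M) with (decided Ord S).
  - apply (decided_truth A rho); eauto using is_class_Ord, Ord_elem.
  - apply class_ext; intros p; split.
    + apply (decided_formula A rho); auto.
    + apply (all_decided A rho); eauto using is_class_Ord, Ord_elem.
Qed.

Lemma ETR_truth : ETR_Ord M -> Ord_omega_truth M.
Proof.
  intros H A HA; destruct (truth_stage_formula A) as (rho & Hrho).
  destruct (H rho A HA) as (S & HS); now apply (solution_truth A rho S).
Qed.
End TruthFromRecursion.

(** * Infinitary definitions of the stages of a recursion *)

Section Translation.
Context {M : gb_structure} {HM : GBC M}.
Implicit Types x y z a b c d e q r i j s m N u : M.
Implicit Types A D L S T X Y : M -> Prop.

(* For all x_k equal to x_m, not q. *)
Definition guard (k : nat) m q : M :=
  fAll (num k) (fNeg (fConj (upair (fEq (num k) m) q))).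

(* The variable of de Bruijn index i among n becomes x_(n-i); the variable x_0
   is kept for the members of [N]. *)
Fixpoint var {n : nat} (i : Fin.t n) : M :=
  match i with @Fin.F1 k => num (S k) | Fin.FS i => var i end.

(* The members of [N] are to be negated definitions of the parts making up the
   class variable 0. *)
Fixpoint translate N {n : nat} (p : formula 2 n) : M :=
  match p with
  | f_eq i j => fEq (var i) (var j)
  | f_mem i j => fMem (var i) (var j)
  | f_in i k =>
      Fin.caseS' k (fun _ => carrier M) (guard 0 (var i) (fConj N)) (fun _ => fIn (var i))
  | f_neg p => fNeg (translate N p)
  | f_and p q => fConj (upair (translate N p) (translate N q))
  | f_all p => fAll (num (S n)) (translate N p)
  end.

(** [psi] is translated with x_1 as its variable, and the members of [N] speak about x_0. The outer
    guard copies x_0 to x_1, as the guard inside [translate] copies a variable to x_0, so x_0 is the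
    only free variable however deep the nesting. The inner negation cancels the one in the guard;
    the outer one makes the result a possible member of the next [N]. *)
Definition negated_stage (psi : formula 2 1) N : M :=
  fNeg (guard 1 (num 0) (fNeg (translate N psi))).

Lemma var_bound {n} (i : Fin.t n) : exists k, 0 < k <= n /\ var i = num k.
Proof.
  induction i as [n|n i (k & Hk & E)]; simpl.
  - exists (S n); split; [lia|easy].
  - exists k; split; [lia|exact E].
Qed.

Lemma var_0 {n} (i : Fin.t n) : var i <> num 0.
Proof. destruct (var_bound i) as (k & Hk & ->); intros E%num_inj; lia. Qed.

Lemma var_S {n} (i : Fin.t n) : var i <> num (S n).
Proof. destruct (var_bound i) as (k & Hk & ->); intros E%num_inj; lia. Qed.

Lemma fo_var {Good n} (i : Fin.t n) : fo_term Good (n := 0) (fun X v => var i).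
Proof. destruct (var_bound i) as (k & _ & ->); apply fo_num. Qed.
Hint Resolve fo_var : fo.

Lemma guard_formula k m q d : is_varset d -> m ∈ d ->
  L_formula_in q (adjoin d (num k)) -> L_formula_in (guard k m q) d.
Proof.
  intros Hd Hm Hq; apply L_formula_in_all.
  assert (Hd' := is_varset_adjoin d (num k) (is_natural_num k) Hd).
  split; [exact Hd|split; [apply is_natural_num|]].
  apply L_formula_in_neg, L_formula_in_conj; split; [exact Hd'|].
  intros r [->| ->]%in_upair; [|exact Hq].
  apply L_formula_in_eq; [exact Hd'| |]; apply in_adjoin; auto.
Qed.

(** The members of [N] end up under quantifiers of the translation, so they must be formulas over
    every variable set that contains x_0. *)
Lemma translate_formula N :
  (forall q d, q ∈ N -> is_varset d -> num 0 ∈ d -> L_formula_in q d) ->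
  forall n (p : formula 2 n) d, is_varset d -> (forall i : Fin.t n, var i ∈ d) ->
  L_formula_in (translate N p) d.
Proof.
  intros HN n p; induction p; intros d Hd Hv; simpl.
  - now apply L_formula_in_eq.
  - now apply L_formula_in_mem.
  - apply (Fin.caseS' k); simpl; [|intros _; now apply L_formula_in_in].
    assert (Hd' := is_varset_adjoin d (num 0) (is_natural_num 0) Hd).
    apply guard_formula; auto; apply L_formula_in_conj; split; [exact Hd'|].
    intros q Hq; apply HN; auto; apply in_adjoin; auto.
  - now apply L_formula_in_neg, IHp.
  - apply L_formula_in_conj; split; [exact Hd|].
    intros r [->| ->]%in_upair; auto.
  - apply L_formula_in_all; split; [exact Hd|split; [apply is_natural_num|]].
    apply IHp; [apply is_varset_adjoin; [apply is_natural_num|exact Hd]|].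
    intros i; apply (Fin.caseS' i); simpl; [|intros j]; apply in_adjoin; auto.
Qed.

Lemma negated_stage_formula psi N d :
  (forall q d, q ∈ N -> is_varset d -> num 0 ∈ d -> L_formula_in q d) ->
  is_varset d -> num 0 ∈ d -> L_formula_in (negated_stage psi N) d.
Proof.
  intros HN Hd H0; apply L_formula_in_neg, guard_formula; auto.
  apply L_formula_in_neg, translate_formula; auto.
  - apply is_varset_adjoin; [apply is_natural_num|exact Hd].
  - intros i; apply (Fin.caseS' i); simpl; [apply in_adjoin; auto|].
    intros i0; apply (Fin.case0 (fun k : Fin.t 0 => var k ∈ adjoin d (num 1))).
Qed.

Lemma fo_translate {Good n} (p : formula 2 n) :
  fo_term Good (n := 1) (fun X v => translate (hd v) p).
Proof.
  induction p; simpl.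
  - fo_tac.
  - fo_tac.
  - apply (Fin.caseS' k); simpl; [|intros _]; unfold guard; fo_tac.
  - apply (fo_term_inst1 fNeg (fun X v => translate (hd v) p)); [fo_side|exact IHp].
  - apply (fo_term_inst1 fConj
      (fun X v => upair (translate (hd v) p1) (translate (hd v) p2))); [fo_side|].
    apply (fo_term_inst2 upair (fun X v => translate (hd v) p1)
      (fun X v => translate (hd v) p2)); [fo_side|exact IHp1|exact IHp2].
  - apply (fo_term_inst2 fAll (fun X v => num (S n)) (fun X v => translate (hd v) p));
      [fo_side|fo_tac|exact IHp].
Qed.

Lemma fo_negated_stage {Good} psi :
  fo_term Good (n := 1) (fun X v => negated_stage psi (hd v)).
Proof.
  set (f := fun y => fNeg (guard 1 (num 0) (fNeg y))).
  change (fo_term Good (n := 1) (fun X v => f (translate (hd v) psi))).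
  apply (fo_term_inst1 f (fun X v => translate (hd v) psi)); [|apply fo_translate].
  unfold f, guard; fo_tac.
Qed.

(** * Truth of the translated formulas *)

Section Semantics.
Context (A D T : M -> Prop).
Hypothesis HT : truth_predicate A D T.
Hypothesis CD : imm_closed D.

Lemma truth_neg q a : D (fNeg q) -> is_valuation a (fNeg q) ->
  (T (opair (fNeg q) a) <-> ~ T (opair q a)).
Proof. intros H V; now rewrite (truth_tarski A D T _ _ HT H V), tarski_neg. Qed.

Lemma truth_conj Q a : D (fConj Q) -> is_valuation a (fConj Q) ->
  (T (opair (fConj Q) a) <-> forall q, q ∈ Q -> T (opair q a)).
Proof. intros H V; now rewrite (truth_tarski A D T _ _ HT H V), tarski_conj. Qed.

Lemma truth_all i q a : D (fAll i q) -> is_valuation a (fAll i q) ->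
  (T (opair (fAll i q) a) <-> forall b a', is_update a' a i b -> T (opair q a')).
Proof. intros H V; now rewrite (truth_tarski A D T _ _ HT H V), tarski_all. Qed.

Lemma valuation_fun a p : is_valuation a p -> exists d, is_fun a d.
Proof. intros (d & H & _); eauto. Qed.

Lemma truth_eq i j x y a : D (fEq i j) -> is_valuation a (fEq i j) ->
  opair i x ∈ a -> opair j y ∈ a -> (T (opair (fEq i j) a) <-> x = y).
Proof.
  intros H V Hx Hy; rewrite (truth_tarski A D T _ _ HT H V), tarski_eq.
  destruct (valuation_fun _ _ V) as (d & Hd); split.
  - intros (z & Hz & Hz').
    now rewrite (is_fun_uniq _ _ _ _ _ Hd Hx Hz), (is_fun_uniq _ _ _ _ _ Hd Hy Hz').
  - intros ->; eauto.
Qed.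

(** The equation leaves [u] as the only relevant value of x_k, so the quantifier acts as an
    assignment. The two variables must differ, or the update would also change the value being
    copied. *)
Lemma truth_guard k m q u a :
  D (guard k m q) -> is_valuation a (guard k m q) -> m <> num k -> opair m u ∈ a ->
  (T (opair (guard k m q) a) <->
   forall a', is_update a' a (num k) u -> ~ T (opair q a')).
Proof.
  intros HD V Hm Hu; unfold guard in *; rewrite truth_all by auto.
  assert (D1 := CD _ _ HD (proj2 (imm_all _ _ _) eq_refl)).
  assert (D2 := CD _ _ D1 (proj2 (imm_neg _ _) eq_refl)).
  assert (D3 : D (fEq (num k) m)).
  { apply (CD _ _ D2), imm_conj, in_upair; auto. }
  assert (E : forall b a', is_update a' a (num k) b ->
    (T (opair (fNeg (fConj (upair (fEq (num k) m) q))) a') <->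
     ~ (b = u /\ T (opair q a')))).
  { intros b a' U.
    assert (V1 := valuation_all _ _ _ _ _ V U); assert (V2 := valuation_neg _ _ V1).
    rewrite truth_neg, truth_conj by auto.
    assert (HE : T (opair (fEq (num k) m) a') <-> b = u).
    { apply truth_eq; auto.
      - apply (valuation_conj _ _ _ V2), in_upair; auto.
      - apply (update_in _ _ _ _ _ _ U); auto.
      - apply (update_in _ _ _ _ _ _ U); auto. }
    rewrite <- HE; split; intros H K; apply H.
    - intros r [->| ->]%in_upair; apply K.
    - split; apply K, in_upair; auto. }
  split.
  - intros H a' U K; now apply (proj1 (E u a' U) (H u a' U)).
  - intros H b a' U; apply (E b a' U); intros [-> K]; exact (H a' U K).
Qed.

Context (N : M) (Y : M -> Prop).
Hypothesis HN : forall a u, is_valuation a (fConj N) -> opair (num 0) u ∈ a ->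
  ((forall q, q ∈ N -> T (opair q a)) <-> ~ Y u).

(** By [HN], the conjunction of [N] says that x_0 is outside [Y]; the guard applies this to the
    variable in question and negates it. *)
Lemma translate_truth n (p : formula 2 n) : forall (v : Vector.t M n) a,
  D (translate N p) -> is_valuation a (translate N p) ->
  (forall i : Fin.t n, opair (var i) (nth v i) ∈ a) ->
  (T (opair (translate N p) a) <-> sat [Y; A] p v).
Proof.
  induction p; intros v a HD V Hv; simpl in *.
  - now apply truth_eq.
  - rewrite (truth_tarski A D T _ _ HT HD V), tarski_mem.
    destruct (valuation_fun _ _ V) as (d & Hd); split.
    + intros (x & y & Hx & Hy & K).
      now rewrite (is_fun_uniq _ _ _ _ _ Hd (Hv i) Hx),
        (is_fun_uniq _ _ _ _ _ Hd (Hv j) Hy).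
    + intros K; eauto.
  - revert HD V; apply (Fin.caseS' k); simpl; intros.
    + rewrite (truth_guard 0 (var i) (fConj N) (nth v i)) by auto using var_0.
      assert (D1 := CD _ _ HD (proj2 (imm_all _ _ _) eq_refl)).
      assert (D2 := CD _ _ D1 (proj2 (imm_neg _ _) eq_refl)).
      assert (D3 : D (fConj N)).
      { apply (CD _ _ D2), imm_conj, in_upair; auto. }
      assert (E : forall a', is_update a' a (num 0) (nth v i) ->
        (T (opair (fConj N) a') <-> ~ Y (nth v i))).
      { intros a' U.
        assert (V1 := valuation_all _ _ _ _ _ V U); assert (V2 := valuation_neg _ _ V1).
        assert (V3 : is_valuation a' (fConj N)).
        { apply (valuation_conj _ _ _ V2), in_upair; auto. }
        rewrite truth_conj by auto; apply HN; [exact V3|].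
        apply (update_in _ _ _ _ _ _ U); auto. }
      split.
      * intros H; destruct (update_exists a (num 0) (nth v i)) as (a' & U).
        apply NNPP; intros K; apply (H a' U), E; auto.
      * intros H a' U K; now apply (E a' U) in K.
    + rewrite (truth_tarski A D T _ _ HT HD V), tarski_in.
      destruct (valuation_fun _ _ V) as (d & Hd).
      apply (Fin.caseS' p); simpl; [|intros p'; apply (Fin.case0 (fun _ => _) p')].
      split; [intros (x & Hx & K)|eauto].
      now rewrite (is_fun_uniq _ _ _ _ _ Hd (Hv i) Hx).
  - rewrite truth_neg by auto.
    assert (D1 := CD _ _ HD (proj2 (imm_neg _ _) eq_refl)).
    now rewrite (IHp v a D1 (valuation_neg _ _ V) Hv).
  - rewrite truth_conj by auto.
    assert (DV : forall q, q ∈ upair (translate N p1) (translate N p2) ->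
      D q /\ is_valuation a q).
    { intros q Hq; split; [apply (CD _ _ HD); now apply imm_conj|].
      now apply (valuation_conj _ _ _ V). }
    setoid_rewrite in_upair in DV; setoid_rewrite in_upair.
    destruct (DV (translate N p1)), (DV (translate N p2)); auto.
    rewrite <- (IHp1 v a), <- (IHp2 v a) by auto; split; [auto|].
    intros [K1 K2] q [->| ->]; auto.
  - rewrite truth_all by auto.
    assert (D1 := CD _ _ HD (proj2 (imm_all _ _ _) eq_refl)).
    assert (E : forall b a', is_update a' a (num (S n)) b ->
      (T (opair (translate N p) a') <-> sat [Y; A] p (b :: v))).
    { intros b a' U; apply IHp; [exact D1|now apply (valuation_all _ _ _ _ _ V U)|].
      intros i; apply (Fin.caseS' i); simpl.
      - apply (update_in _ _ _ _ _ _ U); auto.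
      - intros j; apply (update_in _ _ _ _ _ _ U); right; split; [apply var_S|apply Hv]. }
    split.
    + intros H b; destruct (update_exists a (num (S n)) b) as (a' & U).
      apply (E b a' U), H with b; exact U.
    + intros H b a' U; apply (E b a' U), H.
Qed.

Lemma negated_stage_truth psi a u : D (negated_stage psi N) ->
  is_valuation a (negated_stage psi N) -> opair (num 0) u ∈ a ->
  (T (opair (negated_stage psi N) a) <-> ~ sat [Y; A] psi [u]).
Proof.
  intros HD V Hu; unfold negated_stage in *.
  assert (D1 := CD _ _ HD (proj2 (imm_neg _ _) eq_refl)).
  assert (V1 := valuation_neg _ _ V).
  rewrite truth_neg by auto; apply not_iff_compat.
  rewrite (truth_guard 1 (num 0) _ u) by
    (auto; intros E%num_inj; discriminate).
  assert (D2 := CD _ _ D1 (proj2 (imm_all _ _ _) eq_refl)).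
  assert (D3 := CD _ _ D2 (proj2 (imm_neg _ _) eq_refl)).
  assert (D4 : D (fNeg (translate N psi))).
  { apply (CD _ _ D3), imm_conj, in_upair; auto. }
  assert (D5 := CD _ _ D4 (proj2 (imm_neg _ _) eq_refl)).
  assert (E : forall a', is_update a' a (num 1) u ->
    (~ T (opair (fNeg (translate N psi)) a') <-> sat [Y; A] psi [u])).
  { intros a' U.
    assert (V2 := valuation_all _ _ _ _ _ V1 U); assert (V3 := valuation_neg _ _ V2).
    assert (V4 : is_valuation a' (fNeg (translate N psi))).
    { apply (valuation_conj _ _ _ V3), in_upair; auto. }
    rewrite truth_neg by auto.
    rewrite (translate_truth _ psi [u] a' D5 (valuation_neg _ _ V4)).
    - split; [apply NNPP|auto].
    - intros i; apply (Fin.caseS' i); simpl; [|intros j; apply (Fin.case0 (fun _ => _) j)].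
      apply (update_in _ _ _ _ _ _ U); auto. }
  split.
  - intros H; destruct (update_exists a (num 1) u) as (a' & U).
    apply (E a' U), H, U.
  - intros H a' U; now apply (E a' U).
Qed.
End Semantics.
End Translation.

(** * The stage formulas and the solutions they define *)

Section Stages.
Context {M : gb_structure} {HM : GBC M}.
Implicit Types x y z a b c d e q r m N u w : M.
Implicit Types A D L S T X Y : M -> Prop.

(* The union of the sets {c} ∪ {c} × S_c for c < b determines b, so that the
   next such set is definable from it without mention of b. *)
Definition marked_stage (phi : formula 2 1) A Y u : Prop :=
  exists b, (forall w, w ∈ b <-> Y w /\ Ord w) /\
    (u = b \/ exists y, u = opair b y /\ sat [fun w => Y w /\ ~ Ord w; A] phi [y]).

(** Restricting class variable 0 to non-ordinals strips the markers, and the only class parameter is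
    still [A]. *)
Lemma fo_sat_restr A n (p : formula 2 n) :
  fo (eq A) (fun Y v => sat [fun w => Y w /\ ~ Ord w; A] p v).
Proof.
  induction p; simpl.
  - apply fo_eq_nth.
  - apply fo_mem_nth.
  - apply (Fin.caseS' k); simpl.
    + apply fo_and; [apply fo_X_nth|].
      apply fo_not, (fo_inst1 (fun X v => nth v i)) with (R := fun _ => Ord);
        [apply fo_term_nth|fo_side].
    + intros j; apply (Fin.caseS' j); simpl;
        [|intros j'; apply (Fin.case0 (fun _ => _) j')].
      now apply fo_class_nth.
  - now apply fo_not.
  - now apply fo_and.
  - apply (fo_all (fun Y v x => sat [fun w => Y w /\ ~ Ord w; A] p (x :: v))).
    apply fo_iff with (2 := IHp); intros Y v; now rewrite (eta v).
Qed.

Lemma marked_stage_formula phi A : exists psi : formula 2 1,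
  forall Y u, sat [Y; A] psi [u] <-> marked_stage phi A Y u.
Proof.
  destruct (fo_formula A (fun Y v => marked_stage phi A Y (hd v))) as (psi & H).
  - unfold marked_stage.
    apply (fo_ex (fun Y v b => (forall w, w ∈ b <-> Y w /\ Ord w) /\
      (hd v = b \/ exists y, hd v = opair b y /\
        sat [fun w => Y w /\ ~ Ord w; A] phi [y]))).
    apply (fo_and (fun Y v => forall w, w ∈ hd v <-> Y w /\ Ord w)); [fo_tac|].
    apply (fo_or (fun Y v => hd (tl v) = hd v)); [fo_tac|].
    apply (fo_ex (fun Y v y => hd (tl v) = opair (hd v) y /\
        sat [fun w => Y w /\ ~ Ord w; A] phi [y])).
    apply (fo_and (fun Y v => hd (tl (tl v)) = opair (hd (tl v)) (hd v))); [fo_tac|].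
    apply (fo_inst1 (fun Y v => hd v)) with
      (R := fun Y y => sat [fun w => Y w /\ ~ Ord w; A] phi [y]); [fo_tac|].
    apply fo_iff with (2 := fo_sat_restr A 1 phi).
    intros Y v; rewrite (eta v); apply (case0 (fun t => _ (_ :: t) <-> _ [_])).
    reflexivity.
  - exists psi; intros Y u; apply (H Y [u]).
Qed.

(** A nonempty ordinal contains ∅, but the elements of a Kuratowski pair are nonempty. *)
Lemma Ord_not_opair x y : ~ Ord (opair x y).
Proof.
  intros H; assert (E : emp ∈ opair x y).
  { destruct (Ord_trichotomy emp (opair x y) Ord_emp H) as [K|[K|K]]; auto.
    - now destruct (opair_not_emp x y).
    - now apply not_in_emp in K. }
  apply in_upair in E as [E|E]; apply (not_in_emp x); rewrite E.
  - now apply in_sing.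
  - apply in_upair; auto.
Qed.

Definition point u : M := adjoin emp (opair (num 0) u).
Definition point_dom : M := adjoin emp (num 0).

Lemma point_fun u : is_fun (point u) point_dom.
Proof.
  apply is_fun_adjoin; [|apply not_in_emp].
  apply is_fun_eq; repeat split; intros *; intros H; now apply not_in_emp in H.
Qed.

Lemma in_point u : opair (num 0) u ∈ point u.
Proof. apply in_adjoin; auto. Qed.

Lemma point_dom_varset : is_varset point_dom.
Proof. apply is_varset_adjoin; [apply is_natural_num|apply is_varset_emp]. Qed.

Lemma in_point_dom : num 0 ∈ point_dom.
Proof. apply in_adjoin; auto. Qed.

Section Definitions.
Context (phi psi : formula 2 1) (A : M -> Prop) (nu : M -> M).
Hypothesis Hpsi : forall Y u, sat [Y; A] psi [u] <-> marked_stage phi A Y u.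
Hypothesis Hfo : fo_term (@is_class M) (n := 1) (fun X v => nu (hd v)).
Hint Resolve Hfo : fo.
Hypothesis Hnu : forall b, Ord b -> nu b = negated_stage psi (image nu b).

Lemma stage_formula b : Ord b -> forall d, is_varset d -> num 0 ∈ d ->
  L_formula_in (nu b) d.
Proof.
  revert b; apply (Ord_induction (fun b => forall d, is_varset d -> num 0 ∈ d ->
    L_formula_in (nu b) d)); [solve_class|].
  intros b Hb IH d Hd H0; rewrite Hnu by exact Hb.
  apply negated_stage_formula; auto.
  intros q d' (c & Hc & ->)%in_image; [auto|exact Hfo].
Qed.

Lemma point_valuation b u : Ord b -> is_valuation (point u) (nu b).
Proof.
  intros Hb; exists point_dom; split; [apply point_fun|].
  apply stage_formula; auto using point_dom_varset, in_point_dom.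
Qed.

Context (D T L : M -> Prop).
Hypothesis HT : truth_predicate A D T.
Hypothesis CD : imm_closed D.
Hypothesis HL : is_class L.
Hypothesis L_Ord : forall b, L b -> Ord b.
Hypothesis L_trans : forall b c, L b -> c ∈ b -> L c.
Hypothesis L_D : forall b, L b -> D (nu b).

Let Tclass : is_class T.
Proof. apply HT. Qed.

Let C b u := ~ T (opair (nu b) (point u)).

Let L_induction (P : M -> Prop) : is_class P ->
  (forall b, L b -> (forall c, c ∈ b -> P c) -> P b) -> forall b, L b -> P b.
Proof.
  intros HP H; apply (mem_induction (fun b => L b -> P b)); [solve_class|].
  intros b IH Hb; apply H; eauto.
Qed.

Let fo_point : fo_term (@is_class M) (n := 1) (fun X v => point (hd v)).
Proof. unfold point; fo_tac. Qed.
Hint Resolve fo_point Hfo Tclass HL : fo.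

(** The hypothesis on earlier stages allows any valuation, because inside [nu b] the earlier
    formulas are evaluated with further variables assigned and not at [point u]. *)
Let stage_step b : L b ->
  (forall c, c ∈ b -> forall a u, is_valuation a (nu c) -> opair (num 0) u ∈ a ->
    (T (opair (nu c) a) <-> ~ C c u)) ->
  forall a u, is_valuation a (nu b) -> opair (num 0) u ∈ a ->
    (T (opair (nu b) a) <->
     ~ marked_stage phi A (fun u => exists c, c ∈ b /\ C c u) u).
Proof.
  intros Hb IH a u V Hu.
  assert (Db := L_D b Hb); assert (Eb := Hnu b (L_Ord b Hb)); rewrite Eb in Db, V |- *.
  assert (HN : forall a u, is_valuation a (fConj (image nu b)) -> opair (num 0) u ∈ a ->
    ((forall q, q ∈ image nu b -> T (opair q a)) <-> ~ exists c, c ∈ b /\ C c u)).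
  { intros a' u' V' Hu'; split.
    - intros H (c & Hc & K).
      assert (Hi : nu c ∈ image nu b) by (apply in_image; eauto).
      revert K; apply (IH c Hc a' u'); auto.
      now apply (valuation_conj _ _ _ V').
    - intros H q Hq; assert (Vq := valuation_conj _ _ _ V' Hq).
      apply in_image in Hq as (c & Hc & ->); [|exact Hfo].
      apply (IH c Hc a' u'); auto; intros K; apply H; eauto. }
  now rewrite (negated_stage_truth A D T HT CD _ _ HN psi a u Db V Hu), Hpsi.
Qed.

(** The characterisation in [stage_step] mentions the valuation only through the value of x_0, so by
    induction [point u] stands for all of them. *)
Let stage_point b : L b -> forall a u, is_valuation a (nu b) -> opair (num 0) u ∈ a ->
  (T (opair (nu b) a) <-> ~ C b u).
Proof.
  revert b; apply (L_induction (fun b => forall a u, is_valuation a (nu b) ->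
    opair (num 0) u ∈ a -> (T (opair (nu b) a) <-> ~ C b u))).
  { unfold C; solve_class. }
  intros b Hb IH a u V Hu; unfold C; assert (Ob := L_Ord b Hb).
  rewrite (stage_step b Hb IH a u V Hu),
    (stage_step b Hb IH (point u) u (point_valuation b u Ob) (in_point u)).
  tauto.
Qed.

Let stage_iff b u : L b ->
  (C b u <-> marked_stage phi A (fun u => exists c, c ∈ b /\ C c u) u).
Proof.
  intros Hb; unfold C at 1; assert (Ob := L_Ord b Hb).
  rewrite (stage_step b Hb) with (u := u); auto using point_valuation, in_point.
  - split; [apply NNPP|auto].
  - intros c Hc; apply stage_point; eauto.
Qed.

(** By induction the only ordinal in the marked stage of c is c. Hence the ordinals in the union of
    the stages below [b] make up [b] exactly, which identifies the ordinal quantified in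
    [marked_stage]. *)
Let stage_Ord b u : L b ->
  (C b u <-> u = b \/ exists y, u = opair b y /\
    sat [fun w => (exists c, c ∈ b /\ C c w) /\ ~ Ord w; A] phi [y]).
Proof.
  assert (E : forall b, L b ->
    (forall w, w ∈ b <-> (exists c, c ∈ b /\ C c w) /\ Ord w) ->
    forall u, C b u <-> u = b \/ exists y, u = opair b y /\
    sat [fun w => (exists c, c ∈ b /\ C c w) /\ ~ Ord w; A] phi [y]).
  { clear b u; intros b Hb Eb u; rewrite (stage_iff b u Hb); unfold marked_stage; split.
    - intros (b' & Eb' & H); replace b' with b in H; [exact H|].
      apply set_ext; intros w; rewrite Eb, Eb'; reflexivity.
    - intros H; exists b; auto. }
  intros Hb; apply E; [exact Hb|].
  assert (F : forall b, L b -> C b b /\ forall u, C b u -> Ord u -> u = b).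
  { apply L_induction; [unfold C; solve_class|].
    intros c Hc IH; assert (Ec := E c Hc).
    assert (Ic : forall w, w ∈ c <-> (exists c', c' ∈ c /\ C c' w) /\ Ord w).
    { intros w; split.
      - intros Hw; split; [exists w; split; [exact Hw|now apply IH]|].
        apply (Ord_elem c); auto.
      - intros [(c' & Hc' & K) Ow]; now rewrite (proj2 (IH c' Hc') w K Ow). }
    split; [apply (Ec Ic); now left|].
    intros w Hw Ow; apply (Ec Ic) in Hw as [->|(y & -> & _)]; [easy|].
    now apply Ord_not_opair in Ow. }
  intros w; split.
  - intros Hw; split; [exists w; split; [exact Hw|apply F; eauto]|].
    apply (Ord_elem b); auto.
  - intros [(c & Hc & K) Ow].
    now rewrite (proj2 (F c (L_trans b c Hb Hc)) w K Ow).
Qed.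

Definition solution_of_truth z : Prop :=
  exists b x, L b /\ z = opair b x /\ ~ T (opair (nu b) (point z)).

Lemma solution_of_truth_iff b x : L b ->
  (solution_of_truth (opair b x) <-> C b (opair b x)).
Proof.
  intros Hb; unfold solution_of_truth; split.
  - intros (b' & x' & _ & [-> ->]%opair_inj & K); exact K.
  - intros K; exists b, x; auto.
Qed.

Lemma solution_of_truth_solution : solution phi A L solution_of_truth.
Proof.
  apply solution_iff; split; [|split].
  - unfold solution_of_truth; solve_class.
  - intros p (b & x & Hb & -> & _); eauto.
  - intros b x Hb; rewrite (solution_of_truth_iff b x Hb), (stage_Ord b _ Hb).
    replace (fun w => (exists c, c ∈ b /\ C c w) /\ ~ Ord w) with
      (restr solution_of_truth b).
    + split; [|intros H; right; eauto].
      intros [E|(y & [_ ->]%opair_inj & H)]; [|exact H].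
      destruct (Ord_not_opair b x); rewrite E; auto.
    + apply class_ext; intros w; unfold restr; setoid_rewrite is_opair_eq; split.
      * intros [H (c & y & Hc & ->)]; split; [|apply Ord_not_opair].
        exists c; split; [exact Hc|]; apply solution_of_truth_iff; eauto.
      * intros [(c & Hc & K) N]; assert (Lc : L c) by eauto.
        assert (K' := K); apply stage_Ord in K' as [->|(y & -> & _)]; [|
          split; [now apply solution_of_truth_iff|eauto]|exact Lc].
        destruct N; auto.
Qed.

Lemma stage_truth b a u : L b -> is_valuation a (nu b) -> opair (num 0) u ∈ a ->
  (T (opair (nu b) a) <->
   ~ (u = b \/ exists x, u = opair b x /\ solution_of_truth (opair b x))).
Proof.
  intros Hb V Hu; rewrite (stage_point b Hb a u V Hu); apply not_iff_compat.
  assert (K := stage_Ord b u Hb); split.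
  - intros H; assert (H' := H); apply K in H' as [->|(y & -> & _)]; [now left|].
    right; exists y; split; [easy|]; now apply solution_of_truth_iff.
  - intros [->|(y & -> & H)]; [|now apply solution_of_truth_iff].
    apply stage_Ord; auto.
Qed.
End Definitions.

Lemma stages_exist psi : exists nu : M -> M,
  fo_term (@is_class M) (n := 1) (fun X v => nu (hd v)) /\
  forall b, Ord b -> nu b = negated_stage psi (image nu b).
Proof. apply recursion, fo_negated_stage. Qed.

Lemma truth_ETR : Ord_omega_truth M -> ETR_Ord M.
Proof.
  intros H phi A HA; destruct (H A HA) as (T & HT).
  destruct (marked_stage_formula phi A) as (psi & Hpsi).
  destruct (stages_exist psi) as (nu & Hfo & Hnu).
  exists (solution_of_truth nu T Ord).
  apply (solution_of_truth_solution phi psi A nu Hpsi Hfo Hnu L_formula T Ord HT);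
    eauto using L_formula_imm_closed, is_class_Ord, Ord_elem.
  intros b Hb; exists point_dom.
  apply (stage_formula psi nu); auto using point_dom_varset, in_point_dom.
Qed.
End Stages.

(** * Separation principles and foundation *)

Section Solutions.
Context {M : gb_structure} {HM : GBC M}.
Implicit Types x y z a b c d e q r m N u w : M.
Implicit Types A D L S T X Y W : M -> Prop.

Lemma restr_ext S S' b :
  (forall c x, c ∈ b -> (S (opair c x) <-> S' (opair c x))) -> restr S b = restr S' b.
Proof.
  intros H; apply class_ext; intros z; unfold restr; setoid_rewrite is_opair_eq.
  split; intros [K (c & x & Hc & ->)]; (split; [now apply H|eauto]).
Qed.

Lemma solution_unique phi A L L' S S' : is_class L -> is_class L' ->
  (forall b c, L b -> c ∈ b -> L c) -> (forall b c, L' b -> c ∈ b -> L' c) ->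
  solution phi A L S -> solution phi A L' S' ->
  forall b x, L b -> L' b -> (S (opair b x) <-> S' (opair b x)).
Proof.
  intros HL HL' TL TL' (CS & _ & HS)%solution_iff (CS' & _ & HS')%solution_iff.
  intros b x Hb Hb'; revert x; revert b Hb Hb'.
  apply (mem_induction (fun b => L b -> L' b ->
    forall x, S (opair b x) <-> S' (opair b x))); [solve_class|].
  intros b IH Hb Hb' x; rewrite HS, HS' by assumption.
  rewrite (restr_ext S S' b); [reflexivity|].
  intros c y Hc; apply IH; eauto.
Qed.

Lemma is_class_sat phi A S b : is_class A -> is_class S ->
  is_class (fun x => sat (n := 1) [restr S b; A] phi [x]).
Proof.
  intros HA HS; apply (gbc_comprehension HM (n := 0)).
  constructor; [|now repeat constructor]; unfold restr; solve_class.
Qed.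

(** The next stage is first-order definable from the solution so far. So a recursion cannot first
    fail at a successor length. *)
Lemma solution_succ phi A S b : is_class A -> solution phi A (elems b) S ->
  exists S', solution phi A (elems (succ b)) S'.
Proof.
  intros HA (CS & DS & HS)%solution_iff.
  assert (CP := is_class_sat phi A S b HA CS).
  set (P := fun x => sat [restr S b; A] phi [x]) in *.
  exists (fun z => S z \/ exists x, z = opair b x /\ P x).
  assert (E : forall c, (c ∈ b \/ c = b) ->
    restr (fun z => S z \/ exists x, z = opair b x /\ P x) c = restr S c).
  { intros c Hc; apply restr_ext; intros c' x Hc'; split; [|auto].
    intros [H|(y & [-> _]%opair_inj & _)]; [exact H|].
    destruct Hc as [Hc| ->]; [now destruct (mem_no_2cycle c b)|].
    now destruct (mem_irrefl b). }
  apply solution_iff; split; [solve_class|split].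
  - intros p [H|(x & -> & _)].
    + destruct (DS p H) as (a & x & Ha & ->); exists a, x; split; [|easy].
      apply in_succ; auto.
    + exists b, x; split; [apply in_succ; auto|easy].
  - intros c x Hc; apply in_succ in Hc; rewrite E by exact Hc.
    destruct Hc as [Hc| ->].
    + rewrite <- (HS c x Hc); split; [|auto].
      intros [H|(y & [-> _]%opair_inj & _)]; [exact H|now destruct (mem_irrefl b)].
    + split; [|intros H; right; exists x; auto].
      intros [H|(y & [_ ->]%opair_inj & K)]; [|exact K].
      destruct (DS _ H) as (a & y & Ha & [-> _]%opair_inj); now destruct (mem_irrefl a).
Qed.

(** Solutions of different lengths agree, so a class that collects their last stages is a solution
    of the whole length. The existence of such a [W] is what the separation principles will
    provide. *)
Lemma solution_glue phi A L W : is_class A -> is_class L -> is_class W ->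
  (forall b, L b -> Ord b) -> (forall b c, L b -> c ∈ b -> L c) ->
  (forall b, L b -> exists S, solution phi A (elems (succ b)) S /\
    forall x, W (opair b x) <-> S (opair b x)) ->
  exists S, solution phi A L S.
Proof.
  intros HA HL HW OL TL H.
  exists (fun z => W z /\ exists b x, L b /\ z = opair b x).
  apply solution_iff; split; [solve_class|split].
  - intros p [_ (b & x & Hb & ->)]; eauto.
  - intros b x Hb; destruct (H b Hb) as (S & HS & E).
    assert (HS' := HS); apply solution_iff in HS' as (CS & _ & KS).
    rewrite (restr_ext _ S b).
    + rewrite <- KS by (apply in_succ; auto).
      rewrite <- E; split; [tauto|eauto].
    + intros c y Hc; assert (Lc := TL b c Hb Hc); destruct (H c Lc) as (S' & HS' & E').
      assert (Os := Ord_succ b (OL b Hb)); assert (Os' := Ord_succ c (OL c Lc)).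
      rewrite (solution_unique phi A (elems (succ b)) (elems (succ c)) S S');
        auto using is_class_elems; try (apply in_succ; auto).
      * rewrite <- E'; split; [tauto|eauto].
      * intros c1 c2; apply Ord_trans, Os.
      * intros c1 c2; apply Ord_trans, Os'.
Qed.
End Solutions.

(** * How long it takes to decide the stage formulas *)

Section Heights.
Context {M : gb_structure} {HM : GBC M}.
Implicit Types x y z a b c d e q r m N u w : M.
Implicit Types A D L S T X Y W : M -> Prop.

(** Bounds the number of truth stages that [translate N p] needs after the members of [N] are
    decided. The 3 counts the quantifier, negation and conjunction that a guard puts around
    [fConj N]. *)
Fixpoint height {n : nat} (p : formula 2 n) : nat :=
  match p with
  | f_eq _ _ | f_mem _ _ => 0
  | f_in _ _ => 3
  | f_neg p | f_all p => S (height p)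
  | f_and p q => S (max (height p) (height q))
  end.

Definition succs (k : nat) b : M := Nat.iter k succ b.

Lemma in_succs k b c : c ∈ b -> c ∈ succs k b.
Proof. intros H; induction k; simpl; [exact H|]; apply in_succ; auto. Qed.

Lemma succs_lt k l b : k < l -> succs k b ∈ succs l b.
Proof.
  induction l; intros H; [lia|]; simpl; apply in_succ.
  destruct (Nat.eq_dec k l) as [->|N]; [auto|left; apply IHl; lia].
Qed.

Lemma Ord_succs k b : Ord b -> Ord (succs k b).
Proof. intros H; induction k; simpl; [exact H|now apply Ord_succ]. Qed.

Lemma fo_succs {Good} k : fo_term Good (n := 1) (fun X v => succs k (hd v)).
Proof.
  induction k; simpl; [fo_tac|].
  apply (fo_term_inst1 succ (fun X v => succs k (hd v))); [fo_side|exact IHk].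
Qed.

Section Marks.
Context (A : M -> Prop) (rho : formula 2 1).
Hypothesis Hrho : forall X x, sat [X; A] rho [x] <-> truth_stage A X x.
Context (L S : M -> Prop).
Hypothesis L_trans : forall b c, L b -> c ∈ b -> L c.
Hypothesis HS : solution rho A L S.

Let marked b p := L b /\ S (opair b (opair emp p)).

Let marked_intro b p : L b -> L_formula p ->
  (forall q, imm q p -> exists c, c ∈ b /\ marked c q) -> marked b p.
Proof.
  intros Hb Lp H; split; [exact Hb|]; apply (marked_iff A rho Hrho L S HS); auto.
  split; [exact Lp|]; intros q Hq; destruct (H q Hq) as (c & Hc & _ & K); eauto.
Qed.

Let L_succs k l b : L (succs k b) -> l <= k -> L (succs l b).
Proof.
  intros H Hl; destruct (Nat.eq_dec l k) as [->|N]; [exact H|].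
  apply (L_trans (succs k b)); [exact H|apply succs_lt; lia].
Qed.

Context (N b : M).
Hypothesis HN : forall q, q ∈ N -> exists c, c ∈ b /\ marked c q.

Let marked_conj k : L (succs k b) -> L_formula (fConj N) -> marked (succs k b) (fConj N).
Proof.
  intros Hk LN; apply marked_intro; auto; intros q Hq%imm_conj.
  destruct (HN q Hq) as (c & Hc & K); exists c; split; [now apply in_succs|exact K].
Qed.

Let marked_guard l m q k : (forall k', k <= k' -> L (succs k' b) -> marked (succs k' b) q) ->
  L_formula (guard l m q) ->
  forall k', k + 3 <= k' -> L (succs k' b) -> marked (succs k' b) (guard l m q).
Proof.
  intros H F k' Hk HLk; unfold guard in *.
  assert (F1 := L_formula_imm _ _ F (proj2 (imm_all _ _ _) eq_refl)).
  assert (F2 := L_formula_imm _ _ F1 (proj2 (imm_neg _ _) eq_refl)).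
  assert (F3 : L_formula (fEq (num l) m)).
  { apply (L_formula_imm _ _ F2), imm_conj, in_upair; auto. }
  apply marked_intro; auto; intros r ->%imm_all.
  exists (succs (k' - 1) b); split; [apply succs_lt; lia|].
  apply marked_intro; auto; [apply (L_succs k'); [exact HLk|lia]|]; intros r ->%imm_neg.
  exists (succs (k' - 2) b); split; [apply succs_lt; lia|].
  apply marked_intro; auto; [apply (L_succs k'); [exact HLk|lia]|]; intros r Hr%imm_conj.
  exists (succs (k' - 3) b); split; [apply succs_lt; lia|].
  assert (L3 : L (succs (k' - 3) b)) by (apply (L_succs k'); [exact HLk|lia]).
  apply in_upair in Hr as [->| ->].
  - apply marked_intro; auto; intros r Hr; now apply imm_eq_code in Hr.
  - apply H; [lia|exact L3].
Qed.

(** Stated for all [k] from [height p] on, since the two sides of a conjunction may differ in height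
    but must both be decided before one stage. *)
Lemma marked_translate n (p : formula 2 n) : L_formula (translate N p) ->
  forall k, height p <= k -> L (succs k b) ->
  L (succs k b) /\ S (opair (succs k b) (opair emp (translate N p))).
Proof.
  change (L_formula (translate N p) -> forall k, height p <= k -> L (succs k b) ->
    marked (succs k b) (translate N p)).
  induction p; intros F k' Hk HLk; simpl in *.
  - apply marked_intro; auto; intros q Hq; now apply imm_eq_code in Hq.
  - apply marked_intro; auto; intros q Hq; now apply imm_mem_code in Hq.
  - revert F; apply (Fin.caseS' k); simpl; [|intros _]; intros F.
    + apply (marked_guard 0 (var i) (fConj N) 0); auto.
      intros l _ Hl; apply marked_conj; [exact Hl|].
      assert (F1 := L_formula_imm _ _ F (proj2 (imm_all _ _ _) eq_refl)).
      assert (F2 := L_formula_imm _ _ F1 (proj2 (imm_neg _ _) eq_refl)).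
      apply (L_formula_imm _ _ F2), imm_conj, in_upair; auto.
    + apply marked_intro; auto; intros q Hq; now apply imm_in_code in Hq.
  - apply marked_intro; auto; intros q Hq; assert (Lq := L_formula_imm _ _ F Hq).
    apply imm_neg in Hq as ->.
    exists (succs (k' - 1) b); split; [apply succs_lt; lia|].
    apply IHp; [exact Lq|lia|apply (L_succs k'); [exact HLk|lia]].
  - apply marked_intro; auto; intros q Hq; assert (Lq := L_formula_imm _ _ F Hq).
    apply imm_conj, in_upair in Hq.
    exists (succs (k' - 1) b); split; [apply succs_lt; lia|].
    assert (L1 : L (succs (k' - 1) b)) by (apply (L_succs k'); [exact HLk|lia]).
    destruct Hq as [->| ->]; [apply IHp1|apply IHp2]; auto; lia.
  - apply marked_intro; auto; intros q Hq; assert (Lq := L_formula_imm _ _ F Hq).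
    apply imm_all in Hq as ->.
    exists (succs (k' - 1) b); split; [apply succs_lt; lia|].
    apply IHp; [exact Lq|lia|apply (L_succs k'); [exact HLk|lia]].
Qed.

(** The 5 is one stage for the inner negation, three for the guard and one for the outer
    negation. *)
Lemma marked_negated_stage psi : L_formula (negated_stage psi N) ->
  L (succs (height psi + 5) b) ->
  S (opair (succs (height psi + 5) b) (opair emp (negated_stage psi N))).
Proof.
  intros F HLk; unfold negated_stage in *.
  assert (F0 := L_formula_imm _ _ F (proj2 (imm_neg _ _) eq_refl)).
  assert (F1 := L_formula_imm _ _ F0 (proj2 (imm_all _ _ _) eq_refl)).
  assert (F2 := L_formula_imm _ _ F1 (proj2 (imm_neg _ _) eq_refl)).
  assert (F3 : L_formula (fNeg (translate N psi))).
  { apply (L_formula_imm _ _ F2), imm_conj, in_upair; auto. }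
  assert (F4 := L_formula_imm _ _ F3 (proj2 (imm_neg _ _) eq_refl)).
  apply marked_intro; auto; intros q ->%imm_neg.
  exists (succs (height psi + 4) b); split; [apply succs_lt; lia|].
  apply (marked_guard 1 (num 0) (fNeg (translate N psi)) (height psi + 1)); auto; [|lia|].
  - intros k' Hk HL'; apply marked_intro; auto; intros q ->%imm_neg.
    exists (succs (k' - 1) b); split; [apply succs_lt; lia|].
    apply marked_translate; [exact F4|lia|apply (L_succs k'); [exact HL'|lia]].
  - apply (L_succs (height psi + 5)); [exact HLk|lia].
Qed.
End Marks.

(** * Growth of the deciding stages *)

Section Growth.
Context (k : nat) (g : M -> M).
Hypothesis Hfo : fo_term (@is_class M) (n := 1) (fun X v => g (hd v)).
Hypothesis Hg : forall b, Ord b ->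
  g b = bigcup (image (fun x => succs (S k) x) (image g b)).

(** [g b] is the supremum of g(c) + k + 1 over c < b, that is, (k+1)·b. The formula for stage c will
    be decided at g(c) + k; the extra 1 puts that stage strictly below [g b]. *)
Lemma in_growth b x : Ord b -> x ∈ g b <-> exists c, c ∈ b /\ x ∈ succs (S k) (g c).
Proof.
  intros Hb; rewrite (Hg b Hb), in_bigcup; split.
  - intros (y & Hy & Hx); apply in_image in Hy as (z & Hz & ->); [|apply fo_succs].
    apply in_image in Hz as (c & Hc & ->); [eauto|exact Hfo].
  - intros (c & Hc & Hx); exists (succs (S k) (g c)); split; [|exact Hx].
    apply in_image; [apply fo_succs|]; exists (g c); split; [|easy].
    apply in_image; eauto.
Qed.

Lemma Ord_growth b : Ord b -> Ord (g b).
Proof.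
  revert b; apply (Ord_induction (fun b => Ord (g b))); [solve_class|].
  intros b Hb IH; rewrite (Hg b Hb); apply Ord_bigcup.
  intros y Hy; apply in_image in Hy as (z & Hz & ->); [|apply fo_succs].
  apply in_image in Hz as (c & Hc & ->); [|exact Hfo].
  now apply Ord_succs, IH.
Qed.

(** Zero counts as a limit, so an ordinal is either a successor or a limit. *)
Definition limit b : Prop := Ord b /\ forall x, x ∈ b -> succ x ∈ b.

Lemma limit_succs b l x : limit b -> x ∈ b -> succs l x ∈ b.
Proof. intros [_ H] Hx; induction l; simpl; auto. Qed.

(* Multiplication by a finite number leads out of no limit ordinal. *)
Lemma growth_limit b c : limit b -> c ∈ b -> g c ∈ b.
Proof.
  intros Hb Hc; assert (Oc := Ord_elem _ _ (proj1 Hb) Hc); revert b Hb Hc.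
  revert c Oc; apply (Ord_induction (fun c => forall b, limit b -> c ∈ b -> g c ∈ b)).
  { unfold limit; solve_class. }
  intros c Oc IH b Hb Hc.
  destruct (classic (exists c', c' ∈ c /\ c = succ c')) as [(c' & Hc' & E)|Nc].
  - replace (g c) with (succs (S k) (g c')).
    + apply limit_succs; [exact Hb|]; apply IH; auto.
      apply (Ord_trans b c); auto; apply Hb.
    + apply set_ext; intros x; rewrite in_growth by exact Oc; split; [eauto|].
      intros (c'' & Hc'' & Hx); rewrite E, in_succ in Hc''.
      destruct Hc'' as [Hc''| ->]; [|exact Hx].
      apply in_succs, in_growth; [now apply (Ord_elem c)|eauto].
  - assert (Hl : limit c).
    { split; [exact Oc|]; intros x Hx; destruct (succ_mem_or_eq c x) as [H|H]; auto.
      destruct Nc; eauto. }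
    (* For a limit [c], the induction hypothesis is used with [c] itself as the limit: every g(c')
       with c' < c stays below [c], and so does its supremum up to equality. *)
    assert (Sub : forall x, x ∈ g c -> x ∈ c).
    { intros x (c' & Hc' & Hx)%in_growth; [|exact Oc].
      apply (Ord_trans c (succs (S k) (g c'))); auto.
      apply limit_succs; [exact Hl|]; now apply IH. }
    destruct (Ord_trichotomy (g c) c (Ord_growth c Oc) Oc) as [H|[H|H]].
    + apply (Ord_trans b c); auto; apply Hb.
    + now rewrite H.
    + destruct (mem_irrefl c); now apply Sub.
Qed.
End Growth.
End Heights.

Section Foundation.
Context {M : gb_structure} {HM : GBC M}.
Implicit Types x y z a b c d e p q r m N u w : M.

(** * A truth recursion that breaks down at [L] *)

Section Failure.
Context (A : M -> Prop) (rho psi : formula 2 1) (nu g : M -> M) (L : M -> Prop).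
Hypothesis HA : is_class A.
Hypothesis Hrho : forall X x, sat [X; A] rho [x] <-> truth_stage A X x.
Hypothesis Hpsi : forall Y u, sat [Y; A] psi [u] <-> marked_stage rho A Y u.
Hypothesis Fnu : fo_term (@is_class M) (n := 1) (fun X v => nu (hd v)).
Hypothesis Hnu : forall b, Ord b -> nu b = negated_stage psi (image nu b).
Let k := height psi + 5.
Hypothesis Fg : fo_term (@is_class M) (n := 1) (fun X v => g (hd v)).
Hypothesis Hg : forall b, Ord b ->
  g b = bigcup (image (fun x => succs (S k) x) (image g b)).
Hypothesis HL : L = Ord \/ exists a, Ord a /\ L = elems a.
Hypothesis Hbelow : forall b, L b -> exists S, solution rho A (elems b) S.
Hypothesis Hfail : ~ exists S, solution rho A L S.

Let L_class : is_class L.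
Proof. destruct HL as [->|(a & _ & ->)]; auto using is_class_Ord, is_class_elems. Qed.

Let L_Ord b : L b -> Ord b.
Proof. destruct HL as [->|(a & Ha & ->)]; [auto|apply Ord_elem, Ha]. Qed.

Let L_trans b c : L b -> c ∈ b -> L c.
Proof.
  destruct HL as [->|(a & Ha & ->)]; [apply Ord_elem|].
  unfold elems; apply Ord_trans, Ha.
Qed.

(** If [succ b] were the length itself, a solution of length [b] could be extended by one stage,
    against [Hfail]. *)
Let L_succ b : L b -> L (succ b).
Proof.
  intros Hb; assert (Hb' := Hb); destruct HL as [->|(a & Ha & E)]; [now apply Ord_succ|].
  rewrite E in Hb' |- *; destruct (succ_mem_or_eq a b Ha Hb') as [H|H]; [exact H|].
  destruct Hfail; destruct (Hbelow b Hb) as (S & HS).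
  rewrite E, H; now apply (solution_succ rho A S).
Qed.

Let L_growth b : L b -> L (succs k (g b)).
Proof.
  intros Hb; assert (Hg' : L (g b)).
  { assert (Hb' := Hb); destruct HL as [->|(a & Ha & E)].
    - now apply (Ord_growth k).
    - rewrite E in Hb' |- *; apply (growth_limit k); auto.
      split; [exact Ha|]; intros x Hx; assert (K := L_succ x).
      rewrite E in K; now apply K. }
  generalize k; intros j; induction j; simpl; auto.
Qed.

(** By induction the formulas for c' < c are decided at stages g(c') + k, all below g(c), and [nu c]
    needs only k stages more. *)
Let stage_decided b S : Ord b -> L b -> solution rho A (elems b) S ->
  forall c, Ord c -> succs k (g c) ∈ b -> S (opair (succs k (g c)) (opair emp (nu c))).
Proof.
  intros Ob Lb HS; assert (CS : is_class S) by apply HS.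
  assert (Fk := fo_succs (M := M) (Good := @is_class M) k).
  apply (Ord_induction (fun c => succs k (g c) ∈ b ->
    S (opair (succs k (g c)) (opair emp (nu c))))).
  { apply is_class_fo, (fo_imp (fun X v => succs k (g (hd v)) ∈ b)).
    - fo_tac.
    - fo_tac. }
  intros c Oc IH Hc.
  assert (Fc : L_formula (nu c)).
  { exists point_dom; apply (stage_formula psi nu);
      auto using point_dom_varset, in_point_dom. }
  rewrite (Hnu c Oc) in *.
  apply (marked_negated_stage A rho Hrho (elems b) S); auto.
  - intros x y; apply Ord_trans, Ob.
  - intros q Hq; apply in_image in Hq as (c' & Hc' & ->); [|exact Fnu].
    assert (Hlt : succs k (g c') ∈ g c).
    { apply (in_growth k g Fg Hg c _ Oc); exists c'; split; [exact Hc'|].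
      apply succs_lt; auto. }
    assert (Hb : succs k (g c') ∈ b).
    { apply (Ord_trans b (succs k (g c))); auto; now apply in_succs. }
    exists (succs k (g c')); split; [exact Hlt|]; split; [exact Hb|].
    now apply IH.
Qed.

(** The truth recursion plays both parts here. A solution of some length below [L] yields a truth
    predicate for the formulas up to stage [b], and those formulas then define a solution of length
    b + 1 of the same recursion. *)
Let stage_true b : L b -> exists D T S,
  (is_class D /\ imm_closed D /\ truth_predicate A D T /\ D (nu b)) /\
  solution rho A (elems (succ b)) S /\
  forall a u, is_valuation a (nu b) -> opair (num 0) u ∈ a ->
    (T (opair (nu b) a) <-> ~ (u = b \/ exists x, u = opair b x /\ S (opair b x))).
Proof.
  intros Hb; assert (Ob := L_Ord b Hb); assert (Hm := L_growth b Hb).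
  (* One more than the stage deciding [nu b], so that a solution of length [s] includes that
     stage. *)
  assert (Hs := L_succ _ Hm); set (s := succ (succs k (g b))) in *.
  assert (Os := L_Ord s Hs); destruct (Hbelow s Hs) as (S & HS).
  assert (TS : forall x y, elems s x -> y ∈ x -> elems s y).
  { intros x y; apply Ord_trans, Os. }
  assert (CS := is_class_elems s).
  assert (Ds : forall c, c ∈ succ b -> decided (elems s) S (nu c)).
  { intros c Hc; assert (Oc : Ord c) by (eapply Ord_elem; [apply Ord_succ, Ob|exact Hc]).
    assert (Hcs : succs k (g c) ∈ s).
    { apply in_succ; apply in_succ in Hc as [Hc| ->]; [left|now right].
      apply in_succs, (in_growth k g Fg Hg b _ Ob); exists c; split; [exact Hc|].
      apply succs_lt; auto. }
    exists (succs k (g c)); split; [exact Hcs|]; now apply (stage_decided s). }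
  assert (CD : is_class (decided (elems s) S)).
  { now apply (is_class_decided A rho). }
  assert (ID : imm_closed (decided (elems s) S)).
  { now apply (decided_imm_closed A rho). }
  assert (HT := decided_truth A rho Hrho (elems s) S HA CS TS HS).
  assert (OL : forall c, elems (succ b) c -> Ord c).
  { intros c; apply Ord_elem, Ord_succ, Ob. }
  assert (TL : forall c c', elems (succ b) c -> c' ∈ c -> elems (succ b) c').
  { intros c c'; apply Ord_trans, Ord_succ, Ob. }
  exists (decided (elems s) S), (decided_true (elems s) S),
    (solution_of_truth nu (decided_true (elems s) S) (elems (succ b))).
  split; [|split].
  - split; [exact CD|split; [exact ID|split; [exact HT|]]].
    apply Ds, in_succ; auto.
  - apply (solution_of_truth_solution rho psi A nu Hpsi Fnu Hnu (decided (elems s) S));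
      auto using is_class_elems.
  - intros a u V Hu.
    apply (stage_truth rho psi A nu Hpsi Fnu Hnu (decided (elems s) S)
      (decided_true (elems s) S) (elems (succ b)));
      auto using is_class_elems; apply in_succ; auto.
Qed.

Let stage_code b : Ord b -> exists q, nu b = fNeg q.
Proof. intros Hb; rewrite (Hnu b Hb); eexists; reflexivity. Qed.

Let stage_in b : Ord b -> L_formula_in (nu b) point_dom.
Proof.
  intros Ob; apply (stage_formula psi nu); auto using point_dom_varset, in_point_dom.
Qed.

(** The meet will use [nu b], and the join the formula that [nu b] negates, so both need truth
    predicates. *)
Let stage_true_at b : L b ->
  (exists T, truth_predicate_for A (nu b) T) /\
  (forall q, nu b = fNeg q -> exists T, truth_predicate_for A q T) /\
  exists S, solution rho A (elems (succ b)) S /\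
    forall u,
      (true_at A (nu b) (point u) <->
        ~ (u = b \/ exists x, u = opair b x /\ S (opair b x))) /\
      (forall q, nu b = fNeg q -> (true_at A q (point u) <->
        (u = b \/ exists x, u = opair b x /\ S (opair b x)))).
Proof.
  intros Hb; assert (Ob := L_Ord b Hb).
  destruct (stage_true b Hb) as (D & T & S & (CD & ID & HT & Dn) & HS & K).
  assert (Ln : L_formula (nu b)) by (exists point_dom; auto).
  assert (Q : forall q, nu b = fNeg q -> D q /\ L_formula q).
  { intros q E; split; [apply (ID (nu b))|apply (L_formula_imm (nu b))]; auto;
      rewrite E; now apply imm_neg. }
  split; [eexists; now apply (truth_restrict A D T)|split].
  { intros q E; destruct (Q q E); eexists; now apply (truth_restrict A D T). }
  exists S; split; [exact HS|]; intros u.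
  assert (V := point_valuation psi nu Fnu Hnu b u Ob).
  assert (Ku := K (point u) u V (in_point u)); split.
  - now rewrite (true_at_iff A D T).
  - intros q E; destruct (Q q E) as [Dq Lq]; rewrite (true_at_iff A D T) by auto.
    rewrite E in V, Dn, Ku; rewrite (truth_neg A D T HT q _ Dn V) in Ku.
    split; intros H; [|intros; apply NNPP; intros H'; tauto].
    apply NNPP; tauto.
Qed.

Let point_class (J : M -> Prop) : is_class J -> is_class (fun u => J (point u)).
Proof.
  intros HJ.
  assert (fo_term (@is_class M) (n := 1) (fun X v => point (hd v))) as F
    by (unfold point; fo_tac).
  solve_class.
Qed.

Let class_complement (J : M -> Prop) : is_class J -> is_class (fun u => ~ J u).
Proof. intros HJ; solve_class. Qed.

(** A pair <b,x> carries its own stage: among all the joined formulas only the one for [b] can hold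
    of it. So the join splits back into stages although the formulas carry no index. *)
Lemma join_contradiction : class_join_separation M -> False.
Proof.
  intros HJ; apply Hfail.
  assert (H := HJ A (fun q => exists b, L b /\ nu b = fNeg q) point_dom HA).
  specialize (H ltac:(solve_class) point_dom_varset).
  match type of H with ?P -> ?Q -> is_class ?R =>
    assert (HJc : is_class (fun u => R (point u))); [apply (point_class R), H|] end.
  - intros q (b & Hb & E); apply L_formula_in_neg; rewrite <- E; auto.
  - intros q (b & Hb & E); now apply (stage_true_at b Hb).
  - apply (solution_glue rho A L _ HA L_class HJc L_Ord L_trans).
    intros b Hb; destruct (stage_true_at b Hb) as (_ & _ & S & HS & K).
    exists S; split; [exact HS|]; intros x; split.
    + intros (_ & q & (b' & Hb' & E) & Hq).
      destruct (stage_true_at b' Hb') as (_ & _ & S' & HS' & K').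
      assert (Hq' := Hq); apply (proj2 (K' _) q E) in Hq'.
      destruct Hq' as [Eb|(x' & [<- <-]%opair_inj & _)].
      { destruct (Ord_not_opair b x); rewrite Eb; auto. }
      apply (proj2 (K _) q E) in Hq as [Eb|(x' & [_ <-]%opair_inj & Hx)]; [|exact Hx].
      destruct (Ord_not_opair b x); rewrite Eb; auto.
    + intros Hx; split; [apply point_fun|].
      destruct (stage_code b (L_Ord b Hb)) as (q & E); exists q; split; [eauto|].
      apply (proj2 (K _) q E); eauto.
Qed.

Lemma meet_contradiction : class_meet_separation M -> False.
Proof.
  intros HJ; apply Hfail.
  assert (H := HJ A (fun q => exists b, L b /\ q = nu b) point_dom HA).
  specialize (H ltac:(solve_class) point_dom_varset).
  match type of H with ?P -> ?Q -> is_class ?R =>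
    (* The meet of the negated definitions is the complement of the union of the stages. *)
    assert (HJc : is_class (fun u => ~ R (point u)));
      [apply (point_class (fun a => ~ R a)), (class_complement R), H|] end.
  - intros q (b & Hb & ->); auto.
  - intros q (b & Hb & ->); exact (proj1 (stage_true_at b Hb)).
  - apply (solution_glue rho A L _ HA L_class HJc L_Ord L_trans).
    intros b Hb; destruct (stage_true_at b Hb) as (_ & _ & S & HS & K).
    exists S; split; [exact HS|]; intros x; split.
    + intros N; apply NNPP; intros Nx; apply N; split; [apply point_fun|].
      intros q (b' & Hb' & ->).
      destruct (stage_true_at b' Hb') as (_ & _ & S' & HS' & K').
      apply (proj1 (K' (opair b x))); intros [Eb|(x' & [E <-]%opair_inj & Hx)].
      { destruct (Ord_not_opair b x); rewrite Eb; auto. }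
      subst b'; apply Nx; clear N.
      assert (Os := Ord_succ b (L_Ord b Hb)).
      apply (solution_unique rho A (elems (succ b)) (elems (succ b)) S' S);
        auto using is_class_elems; try (apply in_succ; auto);
        intros c c'; apply Ord_trans, Os.
    + intros Hx (_ & N); apply (proj1 (K (opair b x))) in N; [|eauto].
      apply N; eauto.
Qed.
End Failure.

(** Foundation is applied to the truth recursion alone; the other recursions are then reached
    through [truth_ETR]. *)
Lemma foundation_truth : ETR_Ord_foundation M ->
  class_join_separation M \/ class_meet_separation M -> Ord_omega_truth M.
Proof.
  intros HF Hsep A HA; destruct (truth_stage_formula A) as (rho & Hrho).
  destruct (HF rho A HA) as [(S & HS)|(L & HL & Hbelow & Hfail)].
  { now apply (solution_truth A rho S). }
  destruct (marked_stage_formula rho A) as (psi & Hpsi).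
  destruct (stages_exist psi) as (nu & Fnu & Hnu).
  assert (Fk := fo_succs (M := M) (Good := @is_class M) (S (height psi + 5))).
  (* This [g] is multiplication by [height psi] + 6, one more than the number of stages that each
     new formula takes. *)
  destruct (recursion (fun N => bigcup (image (fun x => succs (S (height psi + 5)) x) N)))
    as (g & Fg & Hg).
  { fo_tac. }
  exfalso; destruct Hsep as [Hsep|Hsep].
  - now apply (join_contradiction A rho psi nu g L).
  - now apply (meet_contradiction A rho psi nu g L).
Qed.
End Foundation.

Theorem theorem25 (M : gb_structure) (HM : GBC M) :
  (ETR_Ord M <-> Ord_omega_truth M) /\
  (ETR_Ord M <-> class_join_separation M /\ ETR_Ord_foundation M) /\
  (ETR_Ord M <-> class_meet_separation M /\ ETR_Ord_foundation M).
Proof.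
  assert (HF : ETR_Ord M -> ETR_Ord_foundation M).
  { intros H phi A HA; left; now apply H. }
  split; [split; [apply ETR_truth|apply truth_ETR]|split].
  - split.
    + intros H; split; [now apply truth_join_meet, ETR_truth|auto].
    + intros [H1 H2]; apply truth_ETR, foundation_truth; auto.
  - split.
    + intros H; split; [now apply truth_join_meet, ETR_truth|auto].
    + intros [H1 H2]; apply truth_ETR, foundation_truth; auto.
Qed.
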